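(* Let $A\subseteq\mathbb{N}$ and let $S_A:=\{(n,\top)\mid n\in A\}\cup\{(n,\bot)\mid n\notin A\}$, regarded as a subspace of $\mathbb{N}\times\mathbb{S}$. The following are equivalent: (1) $S_A$ is computably isomorphic to $\mathbb{N}$. (2) $S_A$ is a complete computable metric space. (3) $S_A$ is computably Quasi-Polish. (4) $S_A$ is computably separable. (5) $S_A$ is computably overt. (6) $A$ is computably enumerable.
   Context: A represented space $\mathbf{X}=(X,\delta_{\mathbf{X}})$ is a set $X$ with a partial surjection $\delta_{\mathbf{X}}:\subseteq\mathbb{N}^{\mathbb{N}}\to X$; any $p$ with $\delta_{\mathbf X}(p)=x$ is a name of $x$. A subspace is a subset with the restricted representation (a point keeps all its names). A realiser of a map $f:\mathbf{X}\to\mathbf{Y}$ is a partial map $R_f:\subseteq\mathbb{N}^{\mathbb{N}}\to\mathbb{N}^{\mathbb{N}}$ sending every name of every $x\in X$ to a name of $f(x)$; $f$ is computable (continuously realisable) if it has a computable (continuous) realiser. A computable isomorphism is a computable bijection with computable inverse. $\mathbb{N}$ is represented by $\delta_{\mathbb N}(p)=p(0)$. $\mathbf{Y}^{\mathbf{X}}$ is the represented space of total continuously realisable functions; a name of $f$ is a $p\in\mathbb N^{\mathbb N}$ coding a realiser of $f$, with $p(0)$ the index of a Turing machine using the oracle $n\mapsto p(n+1)$. In the product $\mathbf{X}\times\mathbf{Y}$, $p$ names $(x,y)$ iff $n\mapsto p(2n)$ names $x$ and $n\mapsto p(2n+1)$ names $y$. Sierpinski space $\mathbb{S}=\{\top,\bot\}$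 is represented so that $0^\omega$ names $\bot$ and every other sequence names $\top$. The space $\mathcal{O}(\mathbf{X})$ of open sets is $\mathbb{S}^{\mathbf{X}}$, identifying $U$ with its characteristic function ($x\mapsto\top$ iff $x\in U$); $U$ is computably open if it has a computable name. $\mathbf{X}$ is computably overt if $\{U\in\mathcal{O}(\mathbf{X})\mid U\neq\emptyset\}$ is computably open in $\mathcal{O}(\mathbf{X})$. $\mathbf{X}$ is computably separable if there is a computable map $s:\mathbb{N}\to\mathbf{X}$ whose image is dense, i.e. meets every non-empty $U\in\mathcal{O}(\mathbf{X})$. For a transitive relation $\ll$ on $\mathbb{N}$, an ideal is a non-empty $I\subseteq\mathbb{N}$ such that $x\ll y\in I$ implies $x\in I$, and for all $x,y\in I$ there is $z\in I$ with $x\ll z$ and $y\ll z$. $\mathbf{I}(\ll)$ is the represented space of ideals, where $p$ names $I$ iff $I=\{p(k)\mid k\in\mathbb{N}\}$. A represented space is precomputably Quasi-Polish if it is computably isomorphic to $\mathbf{I}(\ll)$ for some computably enumerable transitive $\ll$ on $\mathbb N$; it is computably Quasi-Polish if it is moreover computably overt. For a computable pseudometric $d:\mathbb{N}\times\mathbb{N}\to\mathbb{R}$, $\mathbf{X}_d$ is the Cauchy completion of $(\mathbb{N},d)$, where $p$ names $x$ iff $d(p(n),x)<2^{-n}$ for all $n$. A represented space is a complete computable metric space if it is computably isomorphic to some such $\mathbf{X}_d$. *)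

(* Defs.v *)
From Stdlib Require Import Arith Lia ZArith Reals Lra Cantor Wf_nat.
From Stdlib Require Import Classical ClassicalEpsilon FunctionalExtensionality
  PropExtensionality ProofIrrelevance.

Definition baire : Type := nat -> nat.

Definition zero_seq : baire := fun _ => 0.
Definition tail (p : baire) : baire := fun n => p (S n).
Definition evens (p : baire) : baire := fun n => p (2 * n).
Definition odds (p : baire) : baire := fun n => p (2 * n + 1).
Definition join (p q : baire) : baire :=
  fun n => if Nat.even n then p (Nat.div2 n) else q (Nat.div2 n).

(* Programs for the unary partial recursive functions relative to an oracle,
   with tuples coded by the Cantor pairing.  They compute exactly what oracle
   Turing machines compute, and [encode] is an acceptable numbering of them, so
   a "machine index" is below the code of a program. *)
Inductive prog : Type :=
| Zero
| Succ
| Fst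
| Snd
| Oracle
| Pair (f g : prog)
| Comp (f g : prog)
| Rec (f g : prog)
| Mu (f : prog).

Fixpoint encode (c : prog) : nat :=
  match c with
  | Zero => to_nat (0, 0)
  | Succ => to_nat (1, 0)
  | Fst => to_nat (2, 0)
  | Snd => to_nat (3, 0)
  | Oracle => to_nat (4, 0)
  | Pair f g => to_nat (5, to_nat (encode f, encode g))
  | Comp f g => to_nat (6, to_nat (encode f, encode g))
  | Rec f g => to_nat (7, to_nat (encode f, encode g))
  | Mu f => to_nat (8, encode f)
  end.

(* [rec_graph F G x k r]: r is the value at k of the function h defined by
   h 0 = F x and h (S k) = G (x, (k, h k)). *)
Fixpoint rec_graph (F G : nat -> nat -> Prop) (x k r : nat) : Prop :=
  match k with
  | 0 => F x r
  | S k' => exists y, rec_graph F G x k' y /\ G (to_nat (x, to_nat (k', y))) r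
  end.

(* [eval o c n m]: program c with oracle o halts on input n with output m. *)
Fixpoint eval (o : baire) (c : prog) (n m : nat) : Prop :=
  match c with
  | Zero => m = 0
  | Succ => m = S n
  | Fst => m = fst (of_nat n)
  | Snd => m = snd (of_nat n)
  | Oracle => m = o n
  | Pair f g => exists a b, eval o f n a /\ eval o g n b /\ m = to_nat (a, b)
  | Comp f g => exists a, eval o g n a /\ eval o f a m
  | Rec f g =>
      rec_graph (eval o f) (eval o g) (fst (of_nat n)) (snd (of_nat n)) m
  | Mu f =>
      eval o f (to_nat (n, m)) 0 /\
      forall j, j < m -> exists v, eval o f (to_nat (n, j)) (S v)
  end.

Definition computable_seq (p : baire) : Prop :=
  exists c, forall n, eval zero_seq c n (p n).

Definition ce (A : nat -> Prop) : Prop :=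
  exists c, forall n, A n <-> exists m, eval zero_seq c n m.

Definition ce_rel (R : nat -> nat -> Prop) : Prop :=
  ce (fun n => R (fst (of_nat n)) (snd (of_nat n))).

Record pmap : Type := {
  graph :> baire -> baire -> Prop;
  graph_fun : forall p q r, graph p q -> graph p r -> q = r
}.

Definition continuous_pmap (F : pmap) : Prop :=
  forall p q, F p q -> forall n, exists m, forall p' q', F p' q' ->
    (forall i, i < m -> p' i = p i) -> q' n = q n.

Lemma rec_graph_fun F G x k r s :
  (forall a b c, F a b -> F a c -> b = c) ->
  (forall a b c, G a b -> G a c -> b = c) ->
  rec_graph F G x k r -> rec_graph F G x k s -> r = s.
Proof.
  intros HF HG; revert r s; induction k as [|k IH]; simpl; intros r s.
  - apply HF.
  - intros [y [H1 H2]] [z [H3 H4]].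
    rewrite (IH _ _ H3 H1) in H4; eapply HG; eauto.
Qed.

Lemma eval_fun o c n a b : eval o c n a -> eval o c n b -> a = b.
Proof.
  revert n a b; induction c as [| | | | |f IHf g IHg|f IHf g IHg|f IHf g IHg|f IHf];
    simpl; intros n a b; try congruence.
  - intros [x [y [H1 [H2 ->]]]] [x' [y' [H3 [H4 ->]]]].
    rewrite (IHf _ _ _ H1 H3), (IHg _ _ _ H2 H4); reflexivity.
  - intros [x [H1 H2]] [y [H3 H4]].
    rewrite (IHg _ _ _ H3 H1) in H4; eauto.
  - apply rec_graph_fun; eauto.
  - intros [H1 H2] [H3 H4].
    destruct (Nat.lt_trichotomy a b) as [H|[H|H]]; auto.
    + destruct (H4 _ H) as [v Hv]; specialize (IHf _ _ _ H1 Hv); discriminate.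
    + destruct (H2 _ H) as [v Hv]; specialize (IHf _ _ _ H3 Hv); discriminate.
Qed.

(* The argument is the oracle; the n-th entry of the value is the output on
   input n. *)
Program Definition Phi (c : prog) : pmap :=
  {| graph := fun p q => forall n, eval p c n (q n) |}.
Next Obligation.
  apply functional_extensionality; intro n; eapply eval_fun; eauto.
Qed.

Definition computable_pmap (F : pmap) : Prop :=
  exists c, forall p q, F p q -> Phi c p q.

Lemma to_nat_pair_inj a b c d :
  to_nat (a, b) = to_nat (c, d) -> a = c /\ b = d.
Proof.
  intro H; apply (f_equal of_nat) in H; rewrite !cancel_of_to in H.
  inversion H; auto.
Qed.

Lemma encode_inj c d : encode c = encode d -> c = d.
Proof.
  revert d; induction c; intros d H; destruct d; cbn [encode] in H;
    apply to_nat_pair_inj in H; destruct H as [T H];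
    try discriminate T; auto;
    try (apply to_nat_pair_inj in H; destruct H as [H1 H2]);
    f_equal; auto.
Qed.

(* The partial map coded by a point of Baire space: p 0 is the index of a
   program, whose oracle supplies both the rest of p and the argument. *)
Program Definition coded (p : baire) : pmap :=
  {| graph := fun q r => exists c, encode c = p 0 /\ Phi c (join (tail p) q) r |}.
Next Obligation.
  match goal with
  | E : encode ?c = p 0, E' : encode ?d = p 0 |- _ =>
      rewrite <- E' in E; apply encode_inj in E; subst
  end.
  eapply (graph_fun (Phi _)); simpl; eauto.
Qed.

(* [names p x] is the graph of the representation, a partial surjection. *)
Record RepSpace : Type := {
  carrier :> Type;
  names : baire -> carrier -> Prop;
  names_fun : forall p x y, names p x -> names p y -> x = y;
  names_surj : forall x, exists p, names p x
}.
Arguments names {_} _ _.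

Definition realises {X Y : RepSpace} (F : pmap) (f : X -> Y) : Prop :=
  forall p x, names p x -> exists q, F p q /\ names q (f x).

Definition computable {X Y : RepSpace} (f : X -> Y) : Prop :=
  exists F, computable_pmap F /\ realises F f.

Definition cont_realisable {X Y : RepSpace} (f : X -> Y) : Prop :=
  exists F, continuous_pmap F /\ realises F f.

Definition computably_isomorphic (X Y : RepSpace) : Prop :=
  exists (f : X -> Y) (g : Y -> X),
    (forall x, g (f x) = x) /\ (forall y, f (g y) = y) /\
    computable f /\ computable g.

Program Definition Subspace (X : RepSpace) (P : X -> Prop) : RepSpace :=
  {| carrier := {x : X | P x};
     names := fun p x => names p (proj1_sig x) |}.
Next Obligation.
  simpl in *; assert (x = y) by (eapply names_fun; eauto); subst.
  f_equal; apply proof_irrelevance.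
Qed.
Next Obligation. apply names_surj. Qed.

Program Definition Nat_rep : RepSpace :=
  {| carrier := nat; names := fun p n => p 0 = n |}.
Next Obligation. exists (fun _ => x); reflexivity. Qed.

Inductive sierp : Type := top | bot.

Program Definition Sierpinski : RepSpace :=
  {| carrier := sierp;
     names := fun p x => (forall n, p n = 0) <-> x = bot |}.
Next Obligation.
  destruct x, y; auto; exfalso.
  - assert (top = bot) by tauto; discriminate.
  - assert (top = bot) by tauto; discriminate.
Qed.
Next Obligation.
  destruct x.
  - exists (fun _ => 1); split; [intro H; discriminate (H 0) | discriminate].
  - exists zero_seq; split; auto.
Qed.

Lemma evens_join p q : evens (join p q) = p.
Proof.
  apply functional_extensionality; intro n; unfold evens, join.
  rewrite Nat.even_even, Nat.div2_double; reflexivity.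
Qed.

Lemma odds_join p q : odds (join p q) = q.
Proof.
  apply functional_extensionality; intro n; unfold odds, join.
  rewrite Nat.even_odd, Nat.add_1_r, Nat.div2_succ_double; reflexivity.
Qed.

Program Definition Prod (X Y : RepSpace) : RepSpace :=
  {| carrier := (X * Y)%type;
     names := fun p z => names (evens p) (fst z) /\ names (odds p) (snd z) |}.
Next Obligation. f_equal; eapply names_fun; eauto. Qed.
Next Obligation.
  rename c into x, c0 into y.
  destruct (names_surj _ x) as [p Hp], (names_surj _ y) as [q Hq].
  exists (join p q); simpl; rewrite evens_join, odds_join; auto.
Qed.

(* The next lemmas show that every continuously realisable function has a name:
   the oracle tabulates the answers forced by finite prefixes of the argument. *)

Fixpoint prefix_code (q : baire) (k : nat) : nat :=
  match k with
  | 0 => 0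
  | S k => to_nat (prefix_code q k, q k)
  end.

Lemma prefix_code_inj q q' k :
  prefix_code q k = prefix_code q' k -> forall i, i < k -> q i = q' i.
Proof.
  induction k as [|k IH]; intros H i Hi; [lia|].
  cbn [prefix_code] in H; apply to_nat_pair_inj in H; destruct H as [H1 H2].
  destruct (Nat.eq_dec i k) as [->|Hn]; auto; apply IH; auto; lia.
Qed.

Definition forced (F : pmap) (n k s v : nat) : Prop :=
  forall q r, F q r -> prefix_code q k = s -> r n = v.

Definition answer (F : pmap) (n k s : nat) : nat :=
  match excluded_middle_informative (exists v, forced F n k s v) with
  | left H => S (proj1_sig (constructive_indefinite_description _ H))
  | right _ => 0
  end.

Definition answers (F : pmap) : baire := fun i =>
  answer F (fst (of_nat i)) (fst (of_nat (snd (of_nat i))))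
    (snd (of_nat (snd (of_nat i)))).

Lemma answer_correct (F : pmap) q r n k v :
  F q r -> answer F n k (prefix_code q k) = S v -> v = r n.
Proof.
  intro HF; unfold answer; destruct excluded_middle_informative as [H|H];
    [|discriminate].
  destruct constructive_indefinite_description as [w Hw]; simpl.
  injection 1 as <-; symmetry; eapply Hw; eauto.
Qed.

Lemma answer_found (F : pmap) q r n :
  continuous_pmap F -> F q r -> exists k, answer F n k (prefix_code q k) <> 0.
Proof.
  intros HC HF; destruct (HC _ _ HF n) as [k Hk]; exists k.
  unfold answer; destruct excluded_middle_informative as [H|H]; [discriminate|].
  exfalso; apply H; exists (r n); intros q' r' HF' E.
  eapply Hk; eauto; intros i Hi; eapply prefix_code_inj; eauto.
Qed.

Definition computes (o : baire) (c : prog) (f : nat -> nat) : Prop :=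
  forall n, eval o c n (f n).

Lemma computes_pair o c d f g :
  computes o c f -> computes o d g ->
  computes o (Pair c d) (fun n => to_nat (f n, g n)).
Proof. intros H1 H2 n; exists (f n), (g n); auto. Qed.

Lemma computes_comp o c d f g :
  computes o c f -> computes o d g -> computes o (Comp c d) (fun n => f (g n)).
Proof. intros H1 H2 n; exists (g n); auto. Qed.

Lemma computes_rec o c d f g :
  computes o c f -> computes o d g ->
  computes o (Rec c d)
    (fun n => nat_rect (fun _ => nat) (f (fst (of_nat n)))
       (fun k y => g (to_nat (fst (of_nat n), to_nat (k, y)))) (snd (of_nat n))).
Proof.
  intros H1 H2 n; simpl.
  induction (snd (of_nat n)) as [|k IH]; simpl; [apply H1|].
  eexists; split; [exact IH | apply H2].
Qed.

Lemma computes_ext o c f g :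
  (forall n, f n = g n) -> computes o c f -> computes o c g.
Proof. intros E H n; rewrite <- E; apply H. Qed.

Definition pId : prog := Pair Fst Snd.
Definition pDouble : prog :=
  Comp (Rec Zero (Comp Succ (Comp Succ (Comp Snd Snd)))) (Pair Zero pId).
Definition pPred : prog := Comp (Rec Zero (Comp Fst Snd)) (Pair Zero pId).
Definition pIsZero : prog :=
  Comp (Rec (Comp Succ Zero) Zero) (Pair Zero pId).
Definition pPrefix : prog :=
  Rec Zero (Pair (Comp Snd Snd)
    (Comp (Comp Oracle (Comp Succ pDouble)) (Comp Fst Snd))).
Definition pLook : prog :=
  Comp (Comp Oracle pDouble) (Pair Fst (Pair Snd pPrefix)).
Definition pSearch : prog :=
  Comp pPred (Comp pLook (Pair pId (Mu (Comp pIsZero pLook)))).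

Section Search.
Variables (T q : baire).

Lemma pId_correct o : computes o pId (fun n => n).
Proof.
  intro n; exists (fst (of_nat n)), (snd (of_nat n)).
  rewrite <- surjective_pairing, cancel_to_of; repeat split.
Qed.

Lemma computes_rec0 o c d f g :
  computes o c f -> computes o d g ->
  computes o (Comp (Rec c d) (Pair Zero pId))
    (nat_rect (fun _ => nat) (f 0) (fun k y => g (to_nat (0, to_nat (k, y))))).
Proof.
  intros H1 H2; eapply computes_ext;
    [|apply computes_comp;
       [apply (computes_rec o c d f g); assumption
       |apply (computes_pair o Zero pId (fun _ => 0));
          [intro; reflexivity | apply pId_correct]]].
  intro n; cbv beta; rewrite cancel_of_to; reflexivity.
Qed.

Lemma pDouble_correct o : computes o pDouble (fun n => 2 * n).
Proof.
  eapply computes_ext;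
    [|apply (computes_rec0 o _ _ (fun _ => 0)
        (fun n => S (S (snd (of_nat (snd (of_nat n)))))));
      [intro; reflexivity
      |repeat (apply (computes_comp o Succ _ S); [intro; reflexivity|]);
       apply (computes_comp o Snd Snd (fun n => snd (of_nat n))
         (fun n => snd (of_nat n))); intro; reflexivity]].
  induction n as [|n IH]; [reflexivity|].
  cbn [nat_rect]; rewrite IH; repeat (rewrite cancel_of_to; cbn [snd]); lia.
Qed.

Lemma pPred_correct o : computes o pPred Nat.pred.
Proof.
  eapply computes_ext;
    [|apply (computes_rec0 o _ _ (fun _ => 0)
        (fun n => fst (of_nat (snd (of_nat n)))));
      [intro; reflexivity
      |apply (computes_comp o Fst Snd (fun n => fst (of_nat n))
         (fun n => snd (of_nat n))); intro; reflexivity]].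
  destruct n as [|n]; [reflexivity|].
  cbn [nat_rect]; repeat (rewrite cancel_of_to; cbn [fst snd]); reflexivity.
Qed.

Lemma pIsZero_correct o :
  computes o pIsZero (fun n => match n with 0 => 1 | S _ => 0 end).
Proof.
  eapply computes_ext;
    [|apply (computes_rec0 o _ _ (fun _ => 1) (fun _ => 0));
      [apply (computes_comp o Succ Zero S (fun _ => 0)); intro; reflexivity
      |intro; reflexivity]].
  destruct n; reflexivity.
Qed.

Lemma join_even n : join T q (2 * n) = T n.
Proof. exact (f_equal (fun p => p n) (evens_join T q)). Qed.

Lemma join_odd n : join T q (S (2 * n)) = q n.
Proof.
  rewrite <- Nat.add_1_r; exact (f_equal (fun p => p n) (odds_join T q)).
Qed.

Lemma pPrefix_correct :
  computes (join T q) pPrefix (fun n => prefix_code q (snd (of_nat n))).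
Proof.
  eapply computes_ext;
    [|apply (computes_rec _ _ _ (fun _ => 0)
        (fun n => to_nat (snd (of_nat (snd (of_nat n))),
                          join T q (S (2 * fst (of_nat (snd (of_nat n))))))));
      [intro; reflexivity|apply computes_pair]].
  - intro n; cbv beta; induction (snd (of_nat n)) as [|k IH]; [reflexivity|].
    cbn [nat_rect prefix_code]; rewrite IH.
    repeat (rewrite cancel_of_to; cbn [fst snd]).
    rewrite join_odd; reflexivity.
  - apply (computes_comp _ Snd Snd (fun n => snd (of_nat n))
         (fun n => snd (of_nat n))); intro; reflexivity.
  - apply (computes_comp _ _ _ (fun n => join T q (S (2 * n)))).
    + apply (computes_comp _ Oracle); [intro; reflexivity|].
      apply (computes_comp _ Succ _ S); [intro; reflexivity|].
      apply pDouble_correct.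
    + apply (computes_comp _ Fst Snd (fun n => fst (of_nat n))
         (fun n => snd (of_nat n))); intro; reflexivity.
Qed.

Definition look (n k : nat) : nat := T (to_nat (n, to_nat (k, prefix_code q k))).

Lemma pLook_correct :
  computes (join T q) pLook (fun i => look (fst (of_nat i)) (snd (of_nat i))).
Proof.
  eapply computes_ext;
    [|apply (computes_comp _ _ _ (fun n => join T q (2 * n)));
      [apply (computes_comp _ Oracle); [intro; reflexivity|apply pDouble_correct]
      |apply (computes_pair _ Fst _ (fun n => fst (of_nat n)));
        [intro; reflexivity|];
       apply (computes_pair _ Snd _ (fun n => snd (of_nat n)));
        [intro; reflexivity|];
       apply pPrefix_correct]].
  intro n; cbv beta; apply join_even.
Qed.

Lemma pSearch_correct n :
  (exists k, look n k <> 0) ->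
  exists k, look n k <> 0 /\ eval (join T q) pSearch n (Nat.pred (look n k)).
Proof.
  intro H.
  destruct (dec_inh_nat_subset_has_unique_least_element
              (fun k => look n k <> 0)) as [k [[Hk Hmin] _]];
    [intro k; destruct (look n k); auto | exact H |].
  assert (HZ : forall j, eval (join T q) (Comp pIsZero pLook) (to_nat (n, j))
                 (match look n j with 0 => 1 | S _ => 0 end)).
  { intro j; pose proof (computes_comp _ _ _ _ _ (pIsZero_correct (join T q))
      pLook_correct (to_nat (n, j))) as E.
    cbv beta in E; rewrite cancel_of_to in E; exact E. }
  exists k; split; [exact Hk|].
  exists (look n k); split; [|apply pPred_correct].
  exists (to_nat (n, k)); split.
  - exists n, k; split; [apply pId_correct|]; split; [|reflexivity].
    split.
    + specialize (HZ k); destruct (look n k); [congruence|exact HZ].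
    + intros j Hj; specialize (HZ j).
      destruct (look n j) eqn:E; [exists 0; exact HZ|].
      exfalso; assert (k <= j) by (apply Hmin; rewrite E; discriminate); lia.
  - pose proof (pLook_correct (to_nat (n, k))) as E.
    cbv beta in E; rewrite cancel_of_to in E; exact E.
Qed.

End Search.

Lemma cont_realisable_coded (X Y : RepSpace) (f : X -> Y) :
  cont_realisable f -> exists p, realises (coded p) f.
Proof.
  intros [F [HC HF]].
  exists (fun n => match n with 0 => encode pSearch | S i => answers F i end).
  intros q x Hq; destruct (HF _ _ Hq) as [r [HR Hr]].
  exists r; split; [|exact Hr].
  exists pSearch; split; [reflexivity|].
  change (tail _) with (answers F); intro n.
  assert (L : forall k, look (answers F) q n k = answer F n k (prefix_code q k)).
  { intro k; unfold look, answers.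
    repeat (rewrite cancel_of_to; cbn [fst snd]); reflexivity. }
  destruct (pSearch_correct (answers F) q n) as [k [Hk E]].
  { destruct (answer_found F q r n HC HR) as [k Hk]; exists k.
    rewrite L; exact Hk. }
  rewrite L in Hk, E.
  destruct (answer F n k (prefix_code q k)) as [|v] eqn:Ev; [congruence|].
  rewrite <- (answer_correct _ _ _ _ _ _ HR Ev); exact E.
Qed.

Program Definition FunSpace (X Y : RepSpace) : RepSpace :=
  {| carrier := {f : X -> Y | cont_realisable f};
     names := fun p f => realises (coded p) (proj1_sig f) |}.
Next Obligation.
  rename x into f, y into g; simpl in *.
  assert (f = g); [|subst; f_equal; apply proof_irrelevance].
  apply functional_extensionality; intro x.
  destruct (names_surj _ x) as [q Hq].
  destruct (H _ _ Hq) as [r [Hr Nr]], (H0 _ _ Hq) as [s [Hs Ns]].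
  assert (r = s) by (eapply (graph_fun (coded p)); eauto); subst.
  eapply names_fun; eauto.
Qed.
Next Obligation. apply cont_realisable_coded; assumption. Qed.

Definition Opens (X : RepSpace) : RepSpace := FunSpace X Sierpinski.

Definition member {X : RepSpace} (x : X) (U : Opens X) : Prop :=
  proj1_sig U x = top.

Definition nonempty {X : RepSpace} (U : Opens X) : Prop :=
  exists x, member x U.

Definition computably_open {X : RepSpace} (P : X -> Prop) : Prop :=
  exists U : Opens X, (forall x, member x U <-> P x) /\
    exists p, computable_seq p /\ names p U.

Definition computably_overt (X : RepSpace) : Prop :=
  computably_open (fun U : Opens X => nonempty U).

Definition computably_separable (X : RepSpace) : Prop :=
  exists s : Nat_rep -> X, computable s /\
    forall U : Opens X, nonempty U -> exists n, member (s n) U.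

Definition transitive_rel (R : nat -> nat -> Prop) : Prop :=
  forall x y z, R x y -> R y z -> R x z.

Definition ideal (R : nat -> nat -> Prop) (I : nat -> Prop) : Prop :=
  (exists x, I x) /\
  (forall x y, R x y -> I y -> I x) /\
  (forall x y, I x -> I y -> exists z, I z /\ R x z /\ R y z).

Program Definition Ideals (R : nat -> nat -> Prop) : RepSpace :=
  {| carrier := {I : nat -> Prop | ideal R I};
     names := fun p I => forall n, proj1_sig I n <-> exists k, p k = n |}.
Next Obligation.
  rename x into I, y into J; simpl in *.
  assert (I = J); [|subst; f_equal; apply proof_irrelevance].
  apply functional_extensionality; intro n; apply propositional_extensionality.
  rewrite H, H0; tauto.
Qed.
Next Obligation.
  rename x into I; destruct H as [[a Ha] _]; simpl.
  exists (fun n => if excluded_middle_informative (I n) then n else a).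
  intro n; split.
  - intro Hn; exists n; destruct excluded_middle_informative; tauto.
  - intros [k <-]; destruct excluded_middle_informative; auto.
Qed.

Definition precomputably_quasi_polish (X : RepSpace) : Prop :=
  exists R, transitive_rel R /\ ce_rel R /\ computably_isomorphic X (Ideals R).

Definition computably_quasi_polish (X : RepSpace) : Prop :=
  precomputably_quasi_polish X /\ computably_overt X.

Open Scope R_scope.

(* A numbering of the rationals: (a, (b, c)) codes (a - b) / (c + 1). *)
Definition rational (k : nat) : R :=
  let '(a, bc) := of_nat k in
  let '(b, c) := of_nat bc in
  (INR a - INR b) / (INR c + 1).

Lemma inv_pow2_pos n : 0 < / 2 ^ n.
Proof. apply Rinv_0_lt_compat, pow_lt; lra. Qed.

Lemma inv_pow2_small e : 0 < e -> exists N, forall n, (N <= n)%nat -> / 2 ^ n < e.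
Proof.
  intro He; destruct (pow_lt_1_zero (/ 2)) with (y := e) as [N HN]; auto.
  { rewrite Rabs_right; lra. }
  exists N; intros n Hn; specialize (HN n Hn).
  rewrite pow_inv, Rabs_right in HN; auto.
  left; apply inv_pow2_pos.
Qed.

Lemma rational_dense (x : R) n : exists k, Rabs (rational k - x) < / 2 ^ n.
Proof.
  pose (P := (2 ^ S n)%nat).
  assert (HP : INR P = 2 ^ S n) by (unfold P; rewrite pow_INR; reflexivity).
  assert (HP0 : 0 < 2 ^ S n) by (apply pow_lt; lra).
  assert (HP1 : (1 <= P)%nat).
  { clearbody P; destruct P; [cbn [INR] in HP; lra | lia]. }
  pose (z := up (x * 2 ^ S n)).
  exists (to_nat (Z.to_nat z, to_nat (Z.to_nat (- z), (P - 1)%nat))).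
  unfold rational; rewrite cancel_of_to; cbv beta iota;
    rewrite cancel_of_to; cbv beta iota.
  rewrite minus_INR by lia; rewrite HP; change (INR 1) with 1.
  replace (2 ^ S n - 1 + 1) with (2 ^ S n) by ring.
  assert (E : INR (Z.to_nat z) - INR (Z.to_nat (- z)) = IZR z).
  { destruct (Z_le_gt_dec 0 z) as [H|H].
    - rewrite INR_IZR_INZ, Z2Nat.id by lia.
      replace (Z.to_nat (- z)) with 0%nat by lia; simpl; ring.
    - rewrite (INR_IZR_INZ (Z.to_nat (- z))), Z2Nat.id by lia.
      replace (Z.to_nat z) with 0%nat by lia; rewrite opp_IZR; simpl; ring. }
  rewrite E; destruct (archimed (x * 2 ^ S n)) as [A1 A2]; fold z in A1, A2.
  replace (IZR z / 2 ^ S n - x) with ((IZR z - x * 2 ^ S n) * / 2 ^ S n)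
    by (field; lra).
  rewrite Rabs_mult, (Rabs_right (/ 2 ^ S n)), Rabs_right;
    [| lra | left; apply inv_pow2_pos].
  apply Rle_lt_trans with (1 * / 2 ^ S n).
  - apply Rmult_le_compat_r; [left; apply inv_pow2_pos | lra].
  - pose proof (inv_pow2_pos n); simpl; rewrite Rinv_mult; lra.
Qed.

Program Definition Real_rep : RepSpace :=
  {| carrier := R;
     names := fun p x => forall n, Rabs (rational (p n) - x) < / 2 ^ n |}.
Next Obligation.
  destruct (Req_dec x y) as [|Hn]; auto; exfalso.
  assert (He : 0 < Rabs (x - y) / 2).
  { assert (0 < Rabs (x - y)) by (apply Rabs_pos_lt; lra); lra. }
  destruct (inv_pow2_small _ He) as [n Hs].
  specialize (Hs n (le_n _)); specialize (H n); specialize (H0 n).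
  revert H H0 Hs He; unfold Rabs; repeat destruct Rcase_abs; lra.
Qed.
Next Obligation.
  exists (fun n => proj1_sig
    (constructive_indefinite_description _ (rational_dense x n))).
  intro n; destruct constructive_indefinite_description; assumption.
Qed.

Record pseudometric : Type := {
  pdist :> nat -> nat -> R;
  pdist_refl : forall x, pdist x x = 0;
  pdist_sym : forall x y, pdist x y = pdist y x;
  pdist_triangle : forall x y z, pdist x z <= pdist x y + pdist y z
}.

Definition computable_pseudometric (d : pseudometric) : Prop :=
  @computable (Prod Nat_rep Nat_rep) Real_rep (fun z => d (fst z) (snd z)).

Definition cauchy (d : pseudometric) (a : nat -> nat) : Prop :=
  forall e, 0 < e -> exists N, forall m n,
    (N <= m)%nat -> (N <= n)%nat -> d (a m) (a n) < e.

Definition cauchy_equiv (d : pseudometric) (a b : nat -> nat) : Prop :=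
  Un_cv (fun k => d (a k) (b k)) 0.

Definition cauchy_class (d : pseudometric) (C : (nat -> nat) -> Prop) : Prop :=
  exists a, cauchy d a /\ forall b, C b <-> cauchy d b /\ cauchy_equiv d a b.

(* [dist_to_class d n C r]: the class C has distance r, in the completion, from
   the image of n. *)
Definition dist_to_class (d : pseudometric) (n : nat)
    (C : (nat -> nat) -> Prop) (r : R) : Prop :=
  exists a, C a /\ Un_cv (fun k => d n (a k)) r.

Lemma pdist_nonneg (d : pseudometric) x y : 0 <= d x y.
Proof.
  pose proof (pdist_triangle d x y x) as H.
  rewrite pdist_refl, (pdist_sym d y x) in H; lra.
Qed.

Lemma cauchy_equiv_sym d a b : cauchy_equiv d a b -> cauchy_equiv d b a.
Proof.
  intros H e He; destruct (H e He) as [N HN]; exists N; intros n Hn.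
  rewrite pdist_sym; auto.
Qed.

Lemma cauchy_equiv_trans d a b c :
  cauchy_equiv d a b -> cauchy_equiv d b c -> cauchy_equiv d a c.
Proof.
  intros H1 H2 e He.
  destruct (H1 (e / 2)) as [N1 HN1]; [lra|].
  destruct (H2 (e / 2)) as [N2 HN2]; [lra|].
  exists (max N1 N2); intros n Hn.
  specialize (HN1 n ltac:(lia)); specialize (HN2 n ltac:(lia)).
  unfold Rdist in *; rewrite Rminus_0_r in *.
  rewrite Rabs_right in * by (apply Rle_ge, pdist_nonneg).
  pose proof (pdist_triangle d (a n) (b n) (c n)); lra.
Qed.

Lemma eventually_below u r c :
  Un_cv u r -> r < c -> exists N, forall n, (N <= n)%nat -> u n < c.
Proof.
  intros H Hr; destruct (H (c - r)) as [N HN]; [lra|].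
  exists N; intros n Hn; specialize (HN n Hn); unfold Rdist in HN.
  apply Rabs_def2 in HN; lra.
Qed.

Lemma equiv_limit (d : pseudometric) n a b r :
  cauchy_equiv d a b -> Un_cv (fun k => d n (a k)) r ->
  Un_cv (fun k => d n (b k)) r.
Proof.
  intros H1 H2 e He.
  destruct (H1 (e / 2)) as [N1 HN1]; [lra|].
  destruct (H2 (e / 2)) as [N2 HN2]; [lra|].
  exists (max N1 N2); intros k Hk.
  specialize (HN1 k ltac:(lia)); specialize (HN2 k ltac:(lia)).
  unfold Rdist in *; rewrite Rminus_0_r in HN1.
  rewrite Rabs_right in HN1 by (apply Rle_ge, pdist_nonneg).
  apply Rabs_def2 in HN2.
  pose proof (pdist_triangle d n (a k) (b k)).
  pose proof (pdist_triangle d n (b k) (a k)).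
  rewrite (pdist_sym d (b k)) in *.
  apply Rabs_def1; lra.
Qed.

Lemma close_names_equiv (d : pseudometric) (p a b : nat -> nat) :
  (forall n, exists r, Un_cv (fun k => d (p n) (a k)) r /\ r < / 2 ^ n) ->
  (forall n, exists r, Un_cv (fun k => d (p n) (b k)) r /\ r < / 2 ^ n) ->
  cauchy_equiv d a b.
Proof.
  intros HA HB e He.
  destruct (inv_pow2_small (e / 2)) as [n Hn]; [lra|].
  specialize (Hn n (le_n _)).
  destruct (HA n) as [r [Hr Lr]], (HB n) as [s [Hs Ls]].
  destruct (eventually_below _ _ _ Hr Lr) as [N1 HN1].
  destruct (eventually_below _ _ _ Hs Ls) as [N2 HN2].
  exists (max N1 N2); intros k Hk.
  specialize (HN1 k ltac:(lia)); specialize (HN2 k ltac:(lia)); cbv beta in *.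
  unfold Rdist; rewrite Rminus_0_r, Rabs_right by (apply Rle_ge, pdist_nonneg).
  pose proof (pdist_triangle d (a k) (p n) (b k)) as T.
  rewrite (pdist_sym d (a k) (p n)) in T; lra.
Qed.

Lemma cauchy_approx (d : pseudometric) a n :
  cauchy d a ->
  exists m r, Un_cv (fun k => d m (a k)) r /\ r < / 2 ^ n.
Proof.
  intro H; pose proof (inv_pow2_pos n) as P.
  destruct (H (/ 2 ^ n / 2)) as [N HN]; [lra|].
  assert (HC : Cauchy_crit (fun k => d (a N) (a k))).
  { intros e He; destruct (H e He) as [M HM]; exists M; intros i j Hi Hj.
    unfold Rdist; apply Rabs_def1.
    - pose proof (pdist_triangle d (a N) (a j) (a i)).
      specialize (HM j i ltac:(lia) ltac:(lia)); lra.
    - pose proof (pdist_triangle d (a N) (a i) (a j)).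
      specialize (HM i j ltac:(lia) ltac:(lia)); lra. }
  destruct (R_complete _ HC) as [r Hr].
  exists (a N), r; split; [exact Hr|].
  destruct (Rlt_le_dec r (/ 2 ^ n)) as [|L]; auto; exfalso.
  destruct (Hr (/ 2 ^ n / 2)) as [M HM]; [lra|].
  specialize (HM (max N M) ltac:(lia)).
  specialize (HN N (max N M) ltac:(lia) ltac:(lia)).
  unfold Rdist in HM; apply Rabs_def2 in HM; lra.
Qed.

Program Definition Completion (d : pseudometric) : RepSpace :=
  {| carrier := {C : (nat -> nat) -> Prop | cauchy_class d C};
     names := fun p C => forall n, exists r,
       dist_to_class d (p n) (proj1_sig C) r /\ r < / 2 ^ n |}.
Next Obligation.
  rename x into C, y into D, H2 into HC, H1 into HD; simpl in *.
  assert (C = D); [|subst; f_equal; apply proof_irrelevance].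
  destruct HC as [a [Ca HC]], HD as [b [Cb HD]].
  assert (E : cauchy_equiv d a b).
  { apply (close_names_equiv d p).
    - intro n; destruct (H n) as [r [[a' [Ha' L]] Hr]]; exists r; split; auto.
      apply equiv_limit with a'; auto.
      exact (cauchy_equiv_sym _ _ _ (proj2 (proj1 (HC _) Ha'))).
    - intro n; destruct (H0 n) as [r [[b' [Hb' L]] Hr]]; exists r; split; auto.
      apply equiv_limit with b'; auto.
      exact (cauchy_equiv_sym _ _ _ (proj2 (proj1 (HD _) Hb'))). }
  apply functional_extensionality; intro c; apply propositional_extensionality.
  rewrite HC, HD; split; intros [H1 H2]; split; auto.
  - exact (cauchy_equiv_trans _ _ _ _ (cauchy_equiv_sym _ _ _ E) H2).
  - exact (cauchy_equiv_trans _ _ _ _ E H2).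
Qed.
Next Obligation.
  rename x into C; destruct H as [a [Ca HC]]; simpl.
  assert (Ha : C a).
  { apply HC; split; auto; intros e He; exists 0%nat; intros n _.
    unfold Rdist; rewrite pdist_refl, Rminus_0_r, Rabs_R0; lra. }
  exists (fun n => proj1_sig
    (constructive_indefinite_description _ (cauchy_approx d a n Ca))).
  intro n; destruct constructive_indefinite_description as [m [r [L Hr]]]; simpl.
  exists r; split; auto; exists a; auto.
Qed.

Definition complete_computable_metric (X : RepSpace) : Prop :=
  exists d : pseudometric,
    computable_pseudometric d /\ computably_isomorphic X (Completion d).

Close Scope R_scope.

Definition S_space (A : nat -> Prop) : RepSpace :=
  Subspace (Prod Nat_rep Sierpinski)
    (fun z => (A (fst z) /\ snd z = top) \/ (~ A (fst z) /\ snd z = bot)).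

(* Main.v *)
(** A partial recursive function can be simulated for a bounded number of steps,
uniformly in its index and its oracle, by a stack machine whose step function is
primitive recursive.  If [A] is c.e., this lets one write a name of the point of
[S_A] over [n], so [S_A] is isomorphic to [N], which is a discrete complete
metric space and the ideal space of equality; and it lets one search for a
computable point inside an open set given by a name, so [S_A] is overt.
Conversely, the projection to [N] separates the points of [S_A], so a dense
sequence in it is onto, and a computable one enumerates the [n] whose Sierpinski
component is [top].  If [S_A] is overt, then [n] is in [A] iff the open set
of points [(n, top)], which has a name computable from [n], is nonempty. *)
From Stdlib Require Import Arith Lia Reals Lra Cantor List.
From Stdlib Require Import ClassicalEpsilon FunctionalExtensionality
  PropExtensionality ProofIrrelevance.
Require Import Defs.
Import ListNotations.

(** * Effective operators *)

Definition pr (a b : nat) : nat := to_nat (a, b).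
Definition pi1 (n : nat) : nat := fst (of_nat n).
Definition pi2 (n : nat) : nat := snd (of_nat n).

Lemma pi1_pr a b : pi1 (pr a b) = a.
Proof. unfold pi1, pr; rewrite cancel_of_to; reflexivity. Qed.

Lemma pi2_pr a b : pi2 (pr a b) = b.
Proof. unfold pi2, pr; rewrite cancel_of_to; reflexivity. Qed.

(** One program must serve every oracle and halt on every input, so an effective [F] is a total
    computable operator on Baire space; if [F] ignores its oracle, it is a computable sequence. *)
Definition effective (F : baire -> nat -> nat) : Prop :=
  exists c, forall o, computes o c (F o).

Lemma effective_ext F G :
  (forall o n, F o n = G o n) -> effective F -> effective G.
Proof.
  intros E [c H]; exists c; intro o; eapply computes_ext; [apply E | apply H].
Qed.

Lemma effective_comp F G :
  effective F -> effective G -> effective (fun o x => F o (G o x)).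
Proof.
  intros [c H] [d K]; exists (Comp c d); intro o.
  exact (computes_comp o c d _ _ (H o) (K o)).
Qed.

Lemma effective_id : effective (fun _ x => x).
Proof. exists pId; intro o; apply pId_correct. Qed.

Lemma effective_S F : effective F -> effective (fun o x => S (F o x)).
Proof.
  apply (effective_comp (fun _ => S)); exists Succ; intros o n; reflexivity.
Qed.

Lemma effective_const k : effective (fun _ _ => k).
Proof.
  induction k as [|k IH]; [|exact (effective_S _ IH)].
  exists Zero; intros o n; reflexivity.
Qed.

Lemma effective_pi1 F : effective F -> effective (fun o x => pi1 (F o x)).
Proof.
  apply (effective_comp (fun _ => pi1)); exists Fst; intros o n; reflexivity.
Qed.

Lemma effective_pi2 F : effective F -> effective (fun o x => pi2 (F o x)).
Proof.
  apply (effective_comp (fun _ => pi2)); exists Snd; intros o n; reflexivity.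
Qed.

Lemma effective_oracle F : effective F -> effective (fun o x => o (F o x)).
Proof.
  apply (effective_comp (fun o => o)); exists Oracle; intros o n; reflexivity.
Qed.

Lemma effective_pr F G :
  effective F -> effective G -> effective (fun o x => pr (F o x) (G o x)).
Proof.
  intros [c H] [d K]; exists (Pair c d); intro o.
  exact (computes_pair o c d _ _ (H o) (K o)).
Qed.

Lemma effective_rec F G N :
  effective F ->
  effective (fun o z => G o (pi1 z) (pi1 (pi2 z)) (pi2 (pi2 z))) ->
  effective N ->
  effective (fun o x => nat_rect (fun _ => nat) (F o x) (G o x) (N o x)).
Proof.
  intros HF [d Hd] HN.
  assert (HR : effective (fun o z =>
    nat_rect (fun _ => nat) (F o (pi1 z)) (G o (pi1 z)) (pi2 z))).
  { destruct HF as [c Hc]; exists (Rec c d); intro o.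
    eapply computes_ext; [|exact (computes_rec o c d _ _ (Hc o) (Hd o))].
    intro z; cbv beta; change (fst (of_nat z)) with (pi1 z).
    change (snd (of_nat z)) with (pi2 z).
    induction (pi2 z) as [|k IH]; [reflexivity|]; cbn [nat_rect]; rewrite IH.
    change (to_nat (pi1 z, ?u)) with (pr (pi1 z) u).
    rewrite ?pi1_pr, ?pi2_pr.
    match goal with |- context [to_nat (k, ?y)] =>
      change (to_nat (k, y)) with (pr k y) end.
    rewrite pi1_pr, pi2_pr; reflexivity. }
  (* Feeding in [pr x (N o x)] keeps [x] as the parameter of the recursion while its length is
     computed from another copy. *)
  pose proof (effective_comp _ _ HR (effective_pr _ _ effective_id HN)) as H.
  revert H; apply effective_ext; intros o x; cbv beta.
  rewrite pi1_pr, pi2_pr; reflexivity.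
Qed.

Definition ifz (t a b : nat) : nat := match t with 0 => a | S _ => b end.

Lemma effective_ifz T F G :
  effective T -> effective F -> effective G ->
  effective (fun o x => ifz (T o x) (F o x) (G o x)).
Proof.
  intros HT HF HG.
  (* Case distinction is a recursion whose step forgets the previous value. *)
  apply (effective_ext
    (fun o x => nat_rect (fun _ => nat) (F o x) (fun _ _ => G o x) (T o x))).
  - intros o x; destruct (T o x); reflexivity.
  - apply effective_rec; auto.
    apply (effective_comp G); [exact HG|].
    apply effective_pi1, effective_id.
Qed.

Lemma effective_pred F : effective F -> effective (fun o x => pred (F o x)).
Proof.
  apply (effective_comp (fun _ => pred)); exists pPred; intro o.
  apply pPred_correct.
Qed.

Lemma effective_double F : effective F -> effective (fun o x => 2 * F o x).
Proof.
  apply (effective_comp (fun _ x => 2 * x)); exists pDouble; intro o.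
  apply pDouble_correct.
Qed.

Lemma effective_iter F G N :
  effective F ->
  effective (fun o z => G o (pi1 z) (pi2 z)) ->
  effective N ->
  effective (fun o x => Nat.iter (N o x) (G o x) (F o x)).
Proof.
  intros HF HG HN; unfold Nat.iter.
  apply (effective_rec F (fun o x _ => G o x) N); auto.
  apply (effective_ext (fun o z => (fun o z => G o (pi1 z) (pi2 z)) o
    (pr (pi1 z) (pi2 (pi2 z))))).
  - intros o z; rewrite pi1_pr, pi2_pr; reflexivity.
  - apply (effective_comp (fun o z => G o (pi1 z) (pi2 z))); [exact HG|].
    apply effective_pr; [apply effective_pi1 | do 2 apply effective_pi2];
      apply effective_id.
Qed.

Opaque pr pi1 pi2 ifz.

Ltac effective :=
  repeat first
  [ apply effective_const | apply effective_id | apply effective_double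
  | apply effective_S | apply effective_pi1 | apply effective_pi2
  | apply effective_pr | apply effective_ifz | apply effective_pred
  | apply effective_oracle | assumption ].

Lemma effective_sub F G :
  effective F -> effective G -> effective (fun o x => F o x - G o x).
Proof.
  intros HF HG.
  apply (effective_ext (fun o x => Nat.iter (G o x) pred (F o x))).
  - intros o x; induction (G o x) as [|k IH]; cbn; [lia|].
    unfold Nat.iter in IH; rewrite IH; lia.
  - apply (effective_iter _ (fun _ _ => pred)); effective.
Qed.

Lemma effective_add F G :
  effective F -> effective G -> effective (fun o x => F o x + G o x).
Proof.
  intros HF HG.
  apply (effective_ext (fun o x => Nat.iter (G o x) S (F o x))).
  - intros o x; induction (G o x) as [|k IH]; cbn; [lia|].
    unfold Nat.iter in IH; rewrite IH; lia.
  - apply (effective_iter _ (fun _ _ => S)); effective.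
Qed.

(** With truncated subtraction this is 0 exactly when the arguments agree, so [ifz (neqn a b)] tests
    equality. *)
Definition neqn (a b : nat) : nat := (a - b) + (b - a).

Lemma neqn_ifz a b u v :
  ifz (neqn a b) u v = if Nat.eq_dec a b then u else v.
Proof.
  destruct Nat.eq_dec as [->|H].
  - unfold neqn; rewrite Nat.sub_diag; reflexivity.
  - destruct (neqn a b) eqn:E; [unfold neqn in E; lia | reflexivity].
Qed.

Lemma effective_neqn F G :
  effective F -> effective G -> effective (fun o x => neqn (F o x) (G o x)).
Proof.
  intros HF HG; apply effective_add; apply effective_sub; assumption.
Qed.

Lemma effective_join P Q J :
  effective (fun o z => P o (pi1 z) (pi2 z)) ->
  effective (fun o z => Q o (pi1 z) (pi2 z)) ->
  effective J ->
  effective (fun o x => join (P o x) (Q o x) (J o x)).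
Proof.
  intros HP HQ HJ.
  assert (Hpar : effective (fun _ x => Nat.iter x (fun y => ifz y 1 0) 0))
    by (apply (effective_iter _ (fun _ _ y => ifz y 1 0)); effective).
  assert (Epar : forall x, Nat.iter x (fun y => ifz y 1 0) 0 =
    if Nat.even x then 0 else 1).
  { induction x as [|x IH]; [reflexivity|].
    rewrite Nat.iter_succ, IH, Nat.even_succ, <- Nat.negb_even.
    destruct (Nat.even x); reflexivity. }
  assert (Hdiv : effective (fun _ x => Nat.div2 x)).
  (* The iterated state is the pair of parity and half; adding the old parity raises the half
     exactly when an odd number is passed. *)
  { apply (effective_ext (fun _ x => pi2 (Nat.iter x
      (fun y => pr (ifz (pi1 y) 1 0) (pi1 y + pi2 y)) (pr 0 0)))).
    - intros _ x.
      enough (E : Nat.iter x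
          (fun y => pr (ifz (pi1 y) 1 0) (pi1 y + pi2 y)) (pr 0 0) =
        pr (if Nat.even x then 0 else 1) (Nat.div2 x))
        by (rewrite E; apply pi2_pr).
      induction x as [|x IH]; [reflexivity|].
      rewrite Nat.iter_succ, IH, pi1_pr, pi2_pr.
      pose proof (Nat.div2_odd x) as D1; pose proof (Nat.div2_odd (S x)) as D2.
      rewrite Nat.odd_succ in D2.
      rewrite Nat.even_succ; rewrite <- Nat.negb_even in *.
      destruct (Nat.even x); cbn [negb Nat.b2n] in *; f_equal; lia.
    - apply effective_pi2.
      apply (effective_iter _
        (fun _ _ y => pr (ifz (pi1 y) 1 0) (pi1 y + pi2 y))); effective.
      apply effective_add; effective. }
  apply (effective_ext (fun o x =>
    ifz (Nat.iter (J o x) (fun y => ifz y 1 0) 0)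
      (P o (pi1 (pr x (Nat.div2 (J o x)))) (pi2 (pr x (Nat.div2 (J o x)))))
      (Q o (pi1 (pr x (Nat.div2 (J o x)))) (pi2 (pr x (Nat.div2 (J o x))))))).
  - intros o x; rewrite !pi1_pr, !pi2_pr, Epar; unfold join.
    destruct (Nat.even (J o x)); reflexivity.
  - assert (HE : effective (fun o x => pr x (Nat.div2 (J o x)))).
    { effective; apply (effective_comp (fun _ => Nat.div2)); assumption. }
    apply effective_ifz.
    + apply (effective_comp
        (fun _ y => Nat.iter y (fun y => ifz y 1 0) 0)); assumption.
    + exact (effective_comp _ _ HP HE).
    + exact (effective_comp _ _ HQ HE).
Qed.

(** * A universal machine *)

(** This is [nth t l 0], written with [ifz] so that effectiveness can be read off. *)
Fixpoint switch (t : nat) (l : list nat) : nat :=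
  match l with
  | [] => 0
  | a :: l => ifz t a (switch (pred t) l)
  end.

(* A machine state is a call of the program with code [c] on [n], or the return
   of a value [m], on top of a stack [K] of frames.  A frame consists of a tag
   and of data: tags 1 and 2 await the first and the second component of a
   [Pair], 3 the inner value of a [Comp], 4 a value of a [Rec] (with the number
   of rounds done and left), 5 the current test of a [Mu].  The empty stack is 0,
   whose top frame reads as tag 0. *)
Definition call (c n K : nat) : nat := pr 0 (pr c (pr n K)).
(** The padding 0 puts value and stack where a call has its argument and stack. *)
Definition ret (m K : nat) : nat := pr 1 (pr 0 (pr m K)).
Definition push (tag d K : nat) : nat := pr (pr tag d) K.

(** The list is indexed by the constructor tags of [encode]. A [Rec] frame holds the step program,
    the parameter, and the rounds done and left; a [Mu] frame holds the tested program and its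
    current input. *)
Definition call_step (h : baire) (c n K : nat) : nat :=
  switch (pi1 c)
  [ ret 0 K; ret (S n) K; ret (pi1 n) K; ret (pi2 n) K; ret (h n) K;
    call (pi1 (pi2 c)) n (push 1 (pr (pi2 (pi2 c)) n) K);
    call (pi2 (pi2 c)) n (push 3 (pi1 (pi2 c)) K);
    call (pi1 (pi2 c)) (pi1 n)
      (push 4 (pr (pi2 (pi2 c)) (pr (pi1 n) (pr 0 (pi2 n)))) K);
    call (pi2 c) (pr n 0) (push 5 (pr (pi2 c) (pr n 0)) K) ].

(** Tag 0, the empty stack, makes the state a fixed point, so a halted machine keeps its value. *)
Definition ret_step (m K : nat) : nat :=
  let d := pi2 (pi1 K) in
  switch (pi1 (pi1 K))
  [ ret m K;
    call (pi1 d) (pi2 d) (push 2 m (pi2 K));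
    ret (pr d m) (pi2 K);
    call d m (pi2 K);
    ifz (pi2 (pi2 (pi2 d))) (ret m (pi2 K))
      (call (pi1 d) (pr (pi1 (pi2 d)) (pr (pi1 (pi2 (pi2 d))) m))
        (push 4 (pr (pi1 d) (pr (pi1 (pi2 d))
          (pr (S (pi1 (pi2 (pi2 d)))) (pred (pi2 (pi2 (pi2 d))))))) (pi2 K)));
    ifz m (ret (pi2 (pi2 d)) (pi2 K))
      (call (pi1 d) (pr (pi1 (pi2 d)) (S (pi2 (pi2 d))))
        (push 5 (pr (pi1 d) (pr (pi1 (pi2 d)) (S (pi2 (pi2 d))))) (pi2 K))) ].

Definition step (h : baire) (s : nat) : nat :=
  ifz (pi1 s)
    (call_step h (pi1 (pi2 s)) (pi1 (pi2 (pi2 s))) (pi2 (pi2 (pi2 s))))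
    (ret_step (pi1 (pi2 (pi2 s))) (pi2 (pi2 (pi2 s)))).

Definition run (h : baire) (s t : nat) : nat := Nat.iter t (step h) s.

(* [S m] on a state that has halted with value [m], and [0] on other states. *)
Definition output (s : nat) : nat :=
  ifz (pi1 s) 0
    (ifz (pi1 (pi1 (pi2 (pi2 (pi2 s))))) (S (pi1 (pi2 (pi2 s)))) 0).

Definition result (h : baire) (e n t : nat) : nat :=
  output (run h (call e n 0) t).

(** A single step involves no unbounded search, so bounded simulation is total, uniformly in the
    code, the input and the simulated oracle, which may itself vary with [o] and [x]. *)
Lemma effective_result H E N T :
  effective (fun o z => H o (pi1 z) (pi2 z)) ->
  effective E -> effective N -> effective T ->
  effective (fun o x => result (H o x) (E o x) (N o x) (T o x)).
Proof.
  intros HH HE HN HT; unfold result.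
  apply (effective_comp (fun _ => output)).
  { unfold output; effective. }
  apply (effective_iter (fun o x => call (E o x) (N o x) 0)
    (fun o x => step (H o x)) T); auto.
  - unfold call; effective.
  (* The step function consults its oracle only at the argument of the current call. *)
  - assert (HQ : effective (fun o z => H o (pi1 z) (pi1 (pi2 (pi2 (pi2 z)))))).
    { apply (effective_ext (fun o z =>
        (fun o z => H o (pi1 z) (pi2 z)) o
          (pr (pi1 z) (pi1 (pi2 (pi2 (pi2 z))))))).
      - intros o z; rewrite pi1_pr, pi2_pr; reflexivity.
      - apply (effective_comp (fun o z => H o (pi1 z) (pi2 z)));
          [exact HH|]; effective. }
    unfold step, call_step, ret_step, ret, call, push; cbv zeta; cbn [switch].
    effective.
Qed.

Lemma step_call h c n K : step h (call c n K) = call_step h c n K.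
Proof.
  unfold step, call; rewrite ?pi1_pr, ?pi2_pr, ?pi1_pr, ?pi2_pr, ?pi1_pr.
  reflexivity.
Qed.

Lemma step_ret h m K : step h (ret m K) = ret_step m K.
Proof. unfold step, ret; repeat rewrite ?pi1_pr, ?pi2_pr; reflexivity. Qed.

Transparent ifz.

Ltac machine :=
  rewrite ?step_call, ?step_ret; unfold call_step, ret_step, push; cbv zeta;
  cbn [encode]; repeat change (to_nat (?a, ?b)) with (pr a b);
  repeat rewrite ?pi1_pr, ?pi2_pr; cbn [switch pred ifz].

Section Machine.
Variable h : baire.

Definition reach (s s' : nat) : Prop := exists t, run h s t = s'.

Lemma reach_refl s : reach s s.
Proof. exists 0; reflexivity. Qed.

Lemma run_S s t : run h s (S t) = run h (step h s) t.
Proof. apply Nat.iter_succ_r. Qed.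

Lemma reach_step s s' : reach (step h s) s' -> reach s s'.
Proof. intros [t E]; exists (S t); rewrite run_S; exact E. Qed.

Lemma reach_trans s s' s'' : reach s s' -> reach s' s'' -> reach s s''.
Proof.
  intros [t <-] [u <-]; exists (u + t); unfold run; apply Nat.iter_add.
Qed.

(** The stack is arbitrary so that the induction hypotheses apply to subcalls made on top of freshly
    pushed frames. *)
Lemma eval_reach c n m K :
  eval h c n m -> reach (call (encode c) n K) (ret m K).
Proof.
  revert n m K; induction c as [| | | | |f IHf g IHg|f IHf g IHg|f IHf g IHg|f IHf];
    intros n m K; cbn [eval]; intro H; apply reach_step; machine.
  1-5: subst m; exact (reach_refl _).
  - destruct H as (a & b & Ha & Hb & ->).
    eapply reach_trans; [apply IHf, Ha|]; apply reach_step; machine.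
    eapply reach_trans; [apply IHg, Hb|]; apply reach_step; machine.
    apply reach_refl.
  - destruct H as (a & Ha & Hb).
    eapply reach_trans; [apply IHg, Ha|]; apply reach_step; machine.
    apply IHf, Hb.
  - change (fst (of_nat n)) with (pi1 n) in H.
    change (snd (of_nat n)) with (pi2 n) in H.
    (* Loop invariant: of [k + rem] rounds, [k] are done with value [r] and [rem] are left. *)
    assert (HR : forall k rem r,
      rec_graph (eval h f) (eval h g) (pi1 n) k r ->
      reach (call (encode f) (pi1 n)
              (push 4 (pr (encode g) (pr (pi1 n) (pr 0 (k + rem)))) K))
        (ret r (push 4 (pr (encode g) (pr (pi1 n) (pr k rem))) K))).
    { induction k as [|k IH]; intros rem r Hr; [apply IHf, Hr|].
      destruct Hr as (y & Hy & Hr).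
      rewrite Nat.add_succ_comm.
      eapply reach_trans; [apply IH, Hy|]; apply reach_step; machine.
      apply IHg, Hr. }
    specialize (HR (pi2 n) 0 m H); rewrite Nat.add_0_r in HR.
    eapply reach_trans; [exact HR|]; apply reach_step; machine.
    apply reach_refl.
  - destruct H as [H0 Hlt].
    assert (HR : forall i, i <= m ->
      reach (call (encode f) (pr n 0) (push 5 (pr (encode f) (pr n 0)) K))
        (call (encode f) (pr n i) (push 5 (pr (encode f) (pr n i)) K))).
    { induction i as [|i IH]; intro Hi; [apply reach_refl|].
      eapply reach_trans; [apply IH; lia|].
      destruct (Hlt i Hi) as [v Hv].
      eapply reach_trans; [apply IHf, Hv|]; apply reach_step; machine.
      apply reach_refl. }
    eapply reach_trans; [exact (HR m (le_n m))|].
    eapply reach_trans; [apply IHf, H0|]; apply reach_step; machine.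
    apply reach_refl.
Qed.

Definition halted (s : nat) : Prop := output s <> 0.

Lemma halted_call c n K : ~ halted (call c n K).
Proof.
  unfold halted, output, call; rewrite pi1_pr; cbn [ifz]; auto.
Qed.

Lemma halted_ret tag m d K : ~ halted (ret m (push (S tag) d K)).
Proof.
  unfold halted, output, ret, push; rewrite !pi2_pr, !pi1_pr; cbn [ifz]; auto.
Qed.

(** A run can halt only once every frame it pushed has been popped, so the call must have returned.
    The strict bound [u < t] supports the induction on time in the [Mu] case. *)
Lemma halted_run_call c n K s t :
  halted s -> run h (call (encode c) n K) t = s ->
  exists m u, u < t /\ eval h c n m /\ run h (ret m K) u = s.
Proof.
  intro Hs; revert n K t.
  assert (HC : forall e n K t, run h (call e n K) t = s ->
    exists u, t = S u /\ run h (step h (call e n K)) u = s).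
  { intros e n K [|t] E; [|exists t; rewrite <- run_S; auto].
    subst s; destruct (halted_call _ _ _ Hs). }
  assert (HR : forall m tag d K t, run h (ret m (push (S tag) d K)) t = s ->
    exists u, t = S u /\ run h (step h (ret m (push (S tag) d K))) u = s).
  { intros m tag d K [|t] E; [|exists t; rewrite <- run_S; auto].
    subst s; destruct (halted_ret _ _ _ _ Hs). }
  induction c as [| | | | |f IHf g IHg|f IHf g IHg|f IHf g IHg|f IHf];
    intros n K t E; apply HC in E; destruct E as (t0 & -> & E);
    revert E; machine; intro E; cbn [eval].
  1-5: eexists _, t0; split; [lia|]; split; [reflexivity | exact E].
  - apply IHf in E; destruct E as (a & t1 & L1 & Ha & E).
    apply HR in E; destruct E as (t2 & -> & E); revert E; machine; intro E.
    apply IHg in E; destruct E as (b & t3 & L2 & Hb & E).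
    apply HR in E; destruct E as (t4 & -> & E); revert E; machine; intro E.
    exists (pr a b), t4; split; [lia|]; split; [|exact E].
    exists a, b; auto.
  - apply IHg in E; destruct E as (a & t1 & L1 & Ha & E).
    apply HR in E; destruct E as (t2 & -> & E); revert E; machine; intro E.
    apply IHf in E; destruct E as (b & t3 & L2 & Hb & E).
    exists b, t3; split; [lia|]; split; [exists a; auto | exact E].
  - apply IHf in E; destruct E as (a & t1 & L1 & Ha & E).
    (* Induction on the rounds left, where [y] is the value after [k] rounds. *)
    assert (HL : forall rem k y t,
      rec_graph (eval h f) (eval h g) (pi1 n) k y ->
      run h (ret y (push 4 (pr (encode g) (pr (pi1 n) (pr k rem))) K)) t = s ->
      exists m u, u < t /\
        rec_graph (eval h f) (eval h g) (pi1 n) (k + rem) m /\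
        run h (ret m K) u = s).
    { induction rem as [|rem IH]; intros k y t Hy Et;
        apply HR in Et; destruct Et as (t2 & -> & Et);
        revert Et; machine; intro Et.
      - rewrite Nat.add_0_r; exists y, t2; auto.
      - apply IHg in Et; destruct Et as (b & t3 & L3 & Hb & Et).
        apply IH in Et; [|exists y; auto].
        destruct Et as (m & u & L & Hm & Et).
        rewrite <- Nat.add_succ_comm.
        exists m, u; split; [lia | auto]. }
    apply HL in E; [|exact Ha].
    destruct E as (m & u & L & Hm & E); exists m, u; split; [lia | auto].
  (* The number of tests is not known beforehand, so the induction is on the running time; all
     candidates below [j] have already failed. *)
  - assert (HL : forall t j, (forall i, i < j -> exists v, eval h f (pr n i) (S v)) ->
      run h (call (encode f) (pr n j)
        (push 5 (pr (encode f) (pr n j)) K)) t = s ->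
      exists m u, u < t /\ eval h (Mu f) n m /\ run h (ret m K) u = s).
    { induction t as [t IH] using lt_wf_ind; intros j Hj Et.
      apply IHf in Et; destruct Et as (v & t1 & L1 & Hv & Et).
      apply HR in Et; destruct Et as (t2 & -> & Et); revert Et; machine.
      destruct v as [|v]; cbn [ifz]; intro Et.
      - exists j, t2; split; [lia|]; split; [split; assumption | exact Et].
      - apply IH in Et; [|lia|].
        + destruct Et as (m & u & L & Hm & Et); exists m, u.
          split; [lia | auto].
        + intros i Hi; destruct (Nat.eq_dec i j) as [->|]; [eauto|].
          apply Hj; lia. }
    apply HL in E; [|lia].
    destruct E as (m & u & L & Hm & E); exists m, u; split; [lia | auto].
Qed.

Lemma output_ret_empty m : output (ret m 0) = S m.
Proof.
  unfold output, ret; rewrite !pi2_pr, !pi1_pr; reflexivity.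
Qed.

Lemma eval_iff_result c n m :
  eval h c n m <-> exists t, result h (encode c) n t = S m.
Proof.
  unfold result; split.
  - intro H; destruct (eval_reach c n m 0 H) as [t E].
    exists t; rewrite E; apply output_ret_empty.
  - intros [t E].
    assert (Hh : halted (run h (call (encode c) n 0) t))
      by (unfold halted; rewrite E; discriminate).
    destruct (halted_run_call c n 0 _ t Hh eq_refl) as (k & u & _ & Hk & Eu).
    rewrite <- Eu in E.
    (* A return on the empty stack is a fixed point, so the remaining [u] steps change nothing. *)
    assert (HF : run h (ret k 0) u = ret k 0).
    { clear; induction u as [|u IH]; [reflexivity|].
      rewrite run_S, step_ret; exact IH. }
    rewrite HF, output_ret_empty in E; injection E as <-; exact Hk.
Qed.

End Machine.

(** * Oracles and realisers *)

(** Answering oracle queries by a program composes realisers and eliminates computable oracles. *)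
Fixpoint subst (d c : prog) : prog :=
  match c with
  | Oracle => d
  | Pair f g => Pair (subst d f) (subst d g)
  | Comp f g => Comp (subst d f) (subst d g)
  | Rec f g => Rec (subst d f) (subst d g)
  | Mu f => Mu (subst d f)
  | c => c
  end.

Lemma eval_subst o d q c :
  computes o d q -> eval o (subst d c) = eval q c.
Proof.
  intro H.
  induction c as [| | | | |f IHf g IHg|f IHf g IHg|f IHf g IHg|f IHf];
    try reflexivity;
    try (extensionality n; extensionality m; cbn [eval subst];
         rewrite IHf, ?IHg; reflexivity).
  extensionality n; extensionality m; apply propositional_extensionality.
  split; [intro E; exact (eval_fun _ _ _ _ _ E (H n)) | intros ->; apply H].
Qed.

Lemma effective_computable_seq p : computable_seq p -> effective (fun _ => p).
Proof.
  intros [c H]; exists (subst Zero c); intros o n.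
  rewrite (eval_subst o Zero zero_seq); [apply H | intro; reflexivity].
Qed.

(** The use principle: a halting computation asks only finitely many queries. *)
Lemma eval_use o c n m :
  eval o c n m ->
  exists b, forall o', (forall i, i < b -> o' i = o i) -> eval o' c n m.
Proof.
  revert n m; induction c as [| | | | |f IHf g IHg|f IHf g IHg|f IHf g IHg|f IHf];
    intros n m; cbn [eval]; intro H; try (exists 0; intros; exact H).
  - exists (S n); intros o' E; rewrite E; [exact H | lia].
  - destruct H as (x & y & Hx & Hy & ->).
    destruct (IHf _ _ Hx) as [b Hb], (IHg _ _ Hy) as [b' Hb'].
    exists (b + b'); intros o' E; exists x, y.
    split; [|split]; auto; [apply Hb | apply Hb']; intros; apply E; lia.
  - destruct H as (x & Hx & Hy).
    destruct (IHg _ _ Hx) as [b Hb], (IHf _ _ Hy) as [b' Hb'].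
    exists (b + b'); intros o' E; exists x.
    split; auto; [apply Hb | apply Hb']; intros; apply E; lia.
  - revert m H; induction (snd (of_nat n)) as [|k IH]; intros m H;
      [apply IHf, H|].
    destruct H as (y & Hy & H).
    destruct (IH _ Hy) as [b Hb], (IHg _ _ H) as [b' Hb'].
    exists (b + b'); intros o' E; exists y.
    split; auto; [apply Hb | apply Hb']; intros; apply E; lia.
  - destruct H as [H0 Hlt].
    (* The bounds for the finitely many failed tests are added up one test at a time. *)
    assert (HL : forall k, k <= m -> exists b, forall o',
      (forall i, i < b -> o' i = o i) ->
      forall j, j < k -> exists v, eval o' f (to_nat (n, j)) (S v)).
    { induction k as [|k IH]; intro Hk; [exists 0; intros; lia|].
      destruct IH as [b Hb]; [lia|].
      destruct (Hlt k Hk) as [v Hv]; destruct (IHf _ _ Hv) as [b' Hb'].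
      exists (b + b'); intros o' E j Hj.
      destruct (Nat.eq_dec j k) as [->|].
      - exists v; apply Hb'; intros; apply E; lia.
      - apply Hb; [intros; apply E|]; lia. }
    destruct (HL m (le_n m)) as [b Hb], (IHf _ _ H0) as [b' Hb'].
    exists (b + b'); intros o' E; split; [apply Hb' | apply Hb];
      intros; apply E; lia.
Qed.

Lemma Phi_continuous c : continuous_pmap (Phi c).
Proof.
  intros p q H n; destruct (eval_use _ _ _ _ (H n)) as [b Hb].
  exists b; intros p' q' H' E.
  exact (eval_fun _ _ _ _ _ (H' n) (Hb p' E)).
Qed.

Lemma coded_continuous p : continuous_pmap (coded p).
Proof.
  intros q r (c & Ec & Hr) k.
  destruct (Phi_continuous c _ _ Hr k) as [b Hb]; exists b.
  intros q' r' (c' & Ec' & Hr') E.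
  rewrite <- Ec in Ec'; apply encode_inj in Ec'; subst c'.
  apply (Hb _ _ Hr'); intros i Hi; unfold join.
  destruct (Nat.even i); [reflexivity|]; apply E.
  (* Entry [i] of the join reads the argument at [div2 i], which is at most [i], so the bound for
     the join also serves for the argument. *)
  apply Nat.le_lt_trans with i; [|exact Hi].
  rewrite Nat.div2_div; apply Nat.Div0.div_le_upper_bound; lia.
Qed.

Lemma coded_cont_realisable {X Y : RepSpace} (f : X -> Y) p :
  realises (coded p) f -> cont_realisable f.
Proof. exists (coded p); split; [apply coded_continuous | assumption]. Qed.

Lemma computable_program {X Y : RepSpace} (f : X -> Y) :
  computable f <-> exists c, realises (Phi c) f.
Proof.
  split.
  - intros (F & [c Hc] & HF); exists c; intros p x Hp.
    destruct (HF p x Hp) as (q & Hq & Hn); exists q; auto.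
  - intros [c Hc]; exists (Phi c); split; [exists c; auto | exact Hc].
Qed.

Lemma computable_cont {X Y : RepSpace} (f : X -> Y) :
  computable f -> cont_realisable f.
Proof.
  intro H; apply computable_program in H; destruct H as [c Hc].
  exists (Phi c); split; [apply Phi_continuous | exact Hc].
Qed.

Lemma computable_effective {X Y : RepSpace} (f : X -> Y) F :
  effective F -> (forall p x, names p x -> names (F p) (f x)) -> computable f.
Proof.
  intros [c Hc] HF; apply computable_program; exists c; intros p x Hp.
  exists (F p); split; [exact (Hc p) | auto].
Qed.

Lemma computable_comp {X Y Z : RepSpace} (f : X -> Y) (g : Y -> Z) :
  computable f -> computable g -> computable (fun x => g (f x)).
Proof.
  rewrite !computable_program; intros [c Hc] [d Hd]; exists (subst c d).
  intros p x Hp; destruct (Hc p x Hp) as (q & Hq & Hn).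
  destruct (Hd q _ Hn) as (r & Hr & Hm); exists r; split; [|exact Hm].
  intro n; rewrite (eval_subst p c q); [apply Hr | exact Hq].
Qed.

Lemma computably_isomorphic_sym X Y :
  computably_isomorphic X Y -> computably_isomorphic Y X.
Proof. intros (f & g & H1 & H2 & H3 & H4); exists g, f; auto. Qed.

Lemma computably_isomorphic_trans X Y Z :
  computably_isomorphic X Y -> computably_isomorphic Y Z ->
  computably_isomorphic X Z.
Proof.
  intros (f & g & H1 & H2 & H3 & H4) (f' & g' & K1 & K2 & K3 & K4).
  exists (fun x => f' (f x)), (fun z => g (g' z)).
  split; [intro; rewrite K1; auto|]; split; [intro; rewrite H2; auto|].
  split; apply computable_comp; assumption.
Qed.

(** Injectivity follows from [G], which turns a name of a common value into a name of both points.
    The inverse is picked by choice and realised by [G]. *)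
Lemma computably_isomorphic_effective {X Y : RepSpace} (f : X -> Y) F G :
  effective F -> effective G ->
  (forall p x, names p x -> names (F p) (f x)) ->
  (forall q x, names q (f x) -> names (G q) x) ->
  (forall y, exists x, f x = y) ->
  computably_isomorphic X Y.
Proof.
  intros HF HG NF NG Hs.
  pose (g := fun y => proj1_sig (constructive_indefinite_description _ (Hs y))).
  assert (Hg : forall y, f (g y) = y)
    by (intro y; exact (proj2_sig (constructive_indefinite_description _ (Hs y)))).
  exists f, g; split; [|split; [exact Hg|split]].
  - intro x; destruct (names_surj _ (f x)) as [q Hq].
    apply (names_fun _ (G q)); apply NG; [rewrite Hg|]; exact Hq.
  - exact (computable_effective f F HF NF).
  - apply (computable_effective g G HG); intros q y Hq; apply NG.
    rewrite Hg; exact Hq.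
Qed.

(** Normal form of c.e. sets: membership is witnessed by a running time, and conversely minimisation
    finds a witness. *)
Lemma ce_iff A :
  ce A <-> exists a, effective (fun _ => a) /\
    forall n, A n <-> exists t, a (pr n t) <> 0.
Proof.
  split.
  - intros [c Hc].
    exists (fun z => result zero_seq (encode c) (pi1 z) (pi2 z)); split.
    + apply (effective_result (fun _ _ => zero_seq));
        [exact (effective_const 0) | | |]; effective.
    + intro n; rewrite Hc; split.
      * intros [m Hm]; apply eval_iff_result in Hm; destruct Hm as [t Ht].
        exists t; rewrite pi1_pr, pi2_pr, Ht; discriminate.
      * intros [t Ht]; rewrite pi1_pr, pi2_pr in Ht.
        destruct (result zero_seq (encode c) n t) as [|m] eqn:E; [congruence|].
        exists m; apply eval_iff_result; eauto.
  - intros (a & Ha & HA).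
    (* [Mu] stops at a zero, whereas witnesses are non-zero values of [a], so the test is
       inverted. *)
    assert (H0 : effective (fun _ z => ifz (a z) 1 0)).
    { apply effective_ifz; [exact Ha | | ]; apply effective_const. }
    destruct H0 as [c Hc]; specialize (Hc zero_seq).
    exists (Mu c); intro n; rewrite HA; cbn [eval]; split.
    + intro H.
      destruct (dec_inh_nat_subset_has_unique_least_element
        (fun t => a (pr n t) <> 0)) as (k & [Hk Hmin] & _);
        [intro k; destruct (a (pr n k)); auto | exact H |].
      exists k; split.
      * specialize (Hc (pr n k)); cbv beta in Hc.
        destruct (a (pr n k)); [congruence | exact Hc].
      * intros j Hj; exists 0; specialize (Hc (pr n j)); cbv beta in Hc.
        destruct (a (pr n j)) eqn:E; [exact Hc|].
        assert (k <= j) by (apply Hmin; rewrite E; discriminate); lia.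
    + intros (m & Hm & _); exists m; intro E.
      specialize (Hc (pr n m)); cbv beta in Hc; rewrite E in Hc.
      discriminate (eval_fun _ _ _ _ _ Hm Hc).
Qed.

(** * Discrete spaces *)

Lemma dist_to_point (d : pseudometric) m n r :
  dist_to_class d m (fun b => cauchy d b /\ cauchy_equiv d (fun _ => n) b) r <->
  r = d m n.
Proof.
  assert (L : Un_cv (fun _ => d m n) (d m n)).
  { intros e He; exists 0; intros k _; unfold Rdist.
    rewrite Rminus_diag, Rabs_R0; exact He. }
  split.
  - intros (b & [_ Hb] & Hr).
    apply (UL_sequence _ _ _ Hr).
    exact (equiv_limit d m (fun _ => n) b _ Hb L).
  - intros ->; exists (fun _ => n); split; [split|exact L].
    + intros e He; exists 0; intros; rewrite pdist_refl; exact He.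
    + intros e He; exists 0; intros k _; unfold Rdist.
      rewrite pdist_refl, Rminus_0_r, Rabs_R0; exact He.
Qed.

Definition point (d : pseudometric) (n : nat) : Completion d.
Proof.
  exists (fun b => cauchy d b /\ cauchy_equiv d (fun _ => n) b).
  exists (fun _ => n); split; [|reflexivity].
  intros e He; exists 0; intros; rewrite pdist_refl; exact He.
Defined.

Lemma names_point d p n :
  names p (point d n) <-> forall k, (d (p k) n < / 2 ^ k)%R.
Proof.
  split; intros H k.
  - destruct (H k) as (r & Hr & L).
    apply dist_to_point in Hr; rewrite <- Hr; exact L.
  - exists (d (p k) n); split; [apply dist_to_point; reflexivity | apply H].
Qed.

Definition discrete_metric : pseudometric.
Proof.
  refine {| pdist := fun m n => if Nat.eq_dec m n then 0%R else 1%R |}.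
  - intro x; destruct Nat.eq_dec; congruence.
  - intros x y; destruct (Nat.eq_dec x y), (Nat.eq_dec y x); congruence.
  - intros x y z; destruct (Nat.eq_dec x z), (Nat.eq_dec x y), (Nat.eq_dec y z);
      subst; try congruence; lra.
Defined.

Lemma discrete_metric_lt m n : (discrete_metric m n < 1)%R -> m = n.
Proof. simpl; destruct Nat.eq_dec; [auto | lra]. Qed.

Lemma discrete_metric_computable : computable_pseudometric discrete_metric.
Proof.
  (* [p 0] and [p 1] are the two arguments; [pr 0 (pr 0 0)] and [pr 1 (pr 0 0)] code the rationals 0
     and 1 exactly, so constant sequences of them are names. *)
  apply (computable_effective _ (fun p _ =>
    ifz (neqn (p 0) (p 1)) (pr 0 (pr 0 0)) (pr 1 (pr 0 0)))).
  - apply effective_ifz; [apply effective_neqn|..]; effective; apply effective_const.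
  - intros p [x y] [Hx Hy] n; cbn [fst snd] in *.
    rewrite neqn_ifz.
    change (p 0 = x) in Hx; change (p 1 = y) in Hy; subst x y.
    simpl pdist.
    replace (rational _) with (if Nat.eq_dec (p 0) (p 1) then 0%R else 1%R).
    + rewrite Rminus_diag, Rabs_R0; apply inv_pow2_pos.
    + Transparent pr.
      destruct Nat.eq_dec; unfold rational, pr; rewrite !cancel_of_to; simpl; field.
      Opaque pr.
Qed.

(** Discrete distances below 1 vanish, so entry 0 of a name is already the named number, and a
    Cauchy sequence is eventually constant. *)
Lemma Nat_complete_metric : complete_computable_metric Nat_rep.
Proof.
  exists discrete_metric; split; [exact discrete_metric_computable|].
  apply (computably_isomorphic_effective (X := Nat_rep)
    (point discrete_metric) (fun p _ => p 0) (fun q => q)).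
  - effective.
  - effective.
  - intros p n <-; apply names_point; intro k.
    rewrite pdist_refl; apply inv_pow2_pos.
  - intros q n Hq; rewrite names_point in Hq; specialize (Hq 0).
    simpl pow in Hq; rewrite Rinv_1 in Hq.
    exact (discrete_metric_lt _ _ Hq).
  - intros [C [a [Ha HC]]].
    destruct (Ha 1%R Rlt_0_1) as [N HN]; exists (a N).
    apply (names_fun _ (fun _ => a N)).
    + apply names_point; intro k; rewrite pdist_refl; apply inv_pow2_pos.
    + intro k; exists 0%R; split; [|apply inv_pow2_pos].
      exists a; split.
      * apply HC; split; [exact Ha|].
        intros e He; exists 0; intros j _; unfold Rdist.
        rewrite pdist_refl, Rminus_0_r, Rabs_R0; exact He.
      * intros e He; exists N; intros j Hj; cbv beta.
        specialize (HN N j (le_n N) Hj); apply discrete_metric_lt in HN.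
        rewrite <- HN, pdist_refl, Rdist_eq; exact He.
Qed.

(** Directedness forces any two elements of an ideal of [eq] to coincide, so ideals are singletons,
    and an enumeration of one starts with its element. *)
Lemma Nat_precomputably_quasi_polish : precomputably_quasi_polish Nat_rep.
Proof.
  exists eq; split; [intros x y z -> ->; reflexivity|]; split.
  - apply ce_iff.
    exists (fun z => ifz (neqn (pi1 (pi1 z)) (pi2 (pi1 z))) 1 0); split.
    + apply effective_ifz; [apply effective_neqn|..]; effective.
    + intro n; change (pi1 n = pi2 n <->
        exists t, ifz (neqn (pi1 (pi1 (pr n t))) (pi2 (pi1 (pr n t)))) 1 0 <> 0).
      split.
      * intro E; exists 0; rewrite pi1_pr, neqn_ifz.
        destruct Nat.eq_dec; congruence.
      * intros [t Ht]; rewrite pi1_pr, neqn_ifz in Ht.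
        destruct Nat.eq_dec; congruence.
  - assert (HI : forall n : nat, ideal eq (fun m => m = n)).
    { intro n; split; [exists n; reflexivity|].
      split; [intros x y -> E; exact E|].
      intros x y -> ->; exists n; auto. }
    apply (computably_isomorphic_effective (X := Nat_rep) (Y := Ideals eq)
      (fun n => exist _ (fun m => m = n) (HI n)) (fun p _ => p 0) (fun q => q)).
    + effective.
    + effective.
    + intros p n <- m; simpl; split; [intros ->; exists 0; auto|].
      intros [_ <-]; reflexivity.
    + intros q n Hq; apply (Hq (q 0)); exists 0; reflexivity.
    + intros [I HI']; pose proof HI' as ([n Hn] & _ & Hd); exists n.
      assert (EI : (fun m => m = n) = I).
      { extensionality m; apply propositional_extensionality.
        split; [intros ->; exact Hn|]; intro Hm.
        destruct (Hd _ _ Hm Hn) as (z & _ & -> & ->); reflexivity. }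
      subst I; f_equal; apply proof_irrelevance.
Qed.

(** * The equivalences *)

Definition S_point (A : nat -> Prop) (n : nat) : S_space A.
Proof.
  exists (n, if excluded_middle_informative (A n) then top else bot).
  destruct excluded_middle_informative; simpl; auto.
Defined.

(** The subspace condition determines the Sierpinski coordinate from the number, so [S_point A]
    reaches every point. *)
Lemma S_point_eq A (y : S_space A) : S_point A (fst (proj1_sig y)) = y.
Proof.
  destruct y as [[n s] Hs]; unfold S_point.
  match goal with |- exist _ ?z ?H = _ => generalize H end.
  simpl in *; intro H.
  assert (E : (if excluded_middle_informative (A n) then top else bot) = s).
  { destruct excluded_middle_informative;
      destruct Hs as [[Hn ->]|[Hn ->]]; tauto. }
  subst s; f_equal; apply proof_irrelevance.
Qed.

Lemma names_S_point A p n :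
  names p (S_point A n) <-> p 0 = n /\ (A n <-> exists k, odds p k <> 0).
Proof.
  assert (HZ : (forall k, odds p k = 0) <-> ~ exists k, odds p k <> 0).
  { split; [intros H [k Hk]; auto|].
    intros H k; destruct (odds p k) eqn:E; auto.
    exfalso; apply H; exists k; congruence. }
  change (names p (S_point A n)) with (p 0 = n /\ ((forall k, odds p k = 0) <->
    (if excluded_middle_informative (A n) then top else bot) = bot)).
  rewrite HZ; destruct excluded_middle_informative as [H|H].
  - assert (top <> bot) by discriminate; split; intros [H1 H2]; split; auto.
    + split; auto; intros _; apply NNPP; tauto.
    + tauto.
  - tauto.
Qed.

Lemma iso_of_ce A : ce A -> computably_isomorphic Nat_rep (S_space A).
Proof.
  intro H; apply ce_iff in H; destruct H as (a & Ha & HA).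
  (* The Sierpinski half of the name lists the tests [a (pr n k)], one of which is non-zero iff [n]
     is in [A]. Back again, a name of the point has [n] as its entry 0. *)
  apply (computably_isomorphic_effective (X := Nat_rep) (S_point A)
    (fun p => join (fun _ => p 0) (fun k => a (pr (p 0) k))) (fun q => q)).
  - apply effective_join; effective.
    apply (effective_comp (fun _ => a)); effective.
  - effective.
  - intros p n <-; apply names_S_point; split; [reflexivity|].
    rewrite odds_join; apply HA.
  - intros q n Hq; apply names_S_point in Hq; apply Hq.
  - intro y; exists (fst (proj1_sig y)); apply S_point_eq.
Qed.

(* A realiser of the isomorphism reads only a finite prefix of a name, and every
   such prefix extends to a name of some [point d n]. *)
Lemma metric_separable A :
  complete_computable_metric (S_space A) -> computably_separable (S_space A).
Proof.
  intros (d & _ & f & g & Hgf & _ & _ & Hg).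
  exists (fun n => g (point d n)); split.
  - apply (computable_comp (X := Nat_rep) (point d) g); [|exact Hg].
    apply (computable_effective (X := Nat_rep) _ (fun p _ => p 0));
      [effective|].
    intros p n <-; apply names_point; intro k.
    rewrite pdist_refl; apply inv_pow2_pos.
  - intros U [y Hy].
    enough (E : exists n, g (point d n) = y)
      by (destruct E as [n E]; exists n; rewrite E; exact Hy).
    apply computable_program in Hg; destruct Hg as [c Hc].
    destruct (names_surj _ (f y)) as [p Hp].
    destruct (Hc p _ Hp) as (q & Hq & Nq); rewrite Hgf in Nq.
    destruct (eval_use _ _ _ _ (Hq 0)) as [b Hb].
    (* Finitely many strict inequalities hold in the limit, so a late enough term of a Cauchy
       sequence for [f y] satisfies them all. *)
    assert (HN : exists n, forall k, k < b -> (d (p k) n < / 2 ^ k)%R).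
    { destruct (f y) as [C [a [Ha HC]]]; simpl in Hp.
      enough (HN : exists N, forall k, k < b -> forall j, N <= j ->
          (d (p k) (a j) < / 2 ^ k)%R)
        by (destruct HN as [N HN]; exists (a N); auto).
      clear Hb; induction b as [|b [N IH]]; [exists 0; intros; lia|].
      destruct (Hp b) as (r & (a' & Ca & Hr) & Lr).
      apply HC in Ca; destruct Ca as [_ Ca].
      apply (equiv_limit d (p b) a' a) in Hr;
        [|apply cauchy_equiv_sym, Ca].
      destruct (eventually_below _ _ _ Hr Lr) as [M HM].
      exists (N + M); intros k Hk j Hj.
      destruct (Nat.eq_dec k b) as [->|]; [apply HM | apply IH]; lia. }
    destruct HN as [n Hn]; exists n.
    assert (Hp' : names (fun k => if lt_dec k b then p k else n) (point d n)).
    { apply names_point; intro k; destruct lt_dec; [auto|].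
      rewrite pdist_refl; apply inv_pow2_pos. }
    destruct (Hc _ _ Hp') as (q' & Hq' & Nq').
    (* Entry 0 of a name fixes a point of [S_space A], and the realiser gives the same entry 0 on
       both names, as they agree below its use [b]. *)
    rewrite <- (S_point_eq A y), <- (S_point_eq A (g (point d n))) in *.
    apply names_S_point in Nq, Nq'; destruct Nq as [Nq _], Nq' as [Nq' _].
    f_equal; rewrite <- Nq, <- Nq'.
    apply (eval_fun _ _ _ _ _ (Hq' 0)), Hb.
    intros i Hi; destruct lt_dec; [reflexivity | contradiction].
Qed.

Lemma nonzero_top q (x : Sierpinski) :
  names q x -> (x = top <-> exists k, q k <> 0).
Proof.
  intro H; change ((forall n, q n = 0) <-> x = bot) in H.
  destruct x.
  - split; auto; intros _; apply NNPP; intro N.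
    enough (top = bot) by discriminate; apply H; intro k.
    destruct (q k) eqn:E; auto; exfalso; apply N; exists k; congruence.
  - split; [discriminate|]; intros [k Hk]; destruct Hk; apply H; reflexivity.
Qed.

Lemma top_nonzero q (x : Sierpinski) :
  (x = top <-> exists k, q k <> 0) -> names q x.
Proof.
  intro H; change ((forall n, q n = 0) <-> x = bot); split.
  - intro Z; destruct x; auto; exfalso.
    destruct (proj1 H eq_refl) as [k Hk]; auto.
  - intros -> k; destruct (q k) eqn:E; auto.
    enough (bot = top) by discriminate; apply H; exists k; congruence.
Qed.

(** A function-space name with machine index [encode d]; the parameter [n] travels in the oracle
    part, so one program serves all fibres. *)
Definition fibre_code (d : prog) (n : nat) : baire :=
  fun i => ifz i (encode d) n.

Lemma fibre_program : exists d, forall A n, exists U : Opens (S_space A),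
  names (fibre_code d n) U /\
  forall y, member y U <-> fst (proj1_sig y) = n /\ snd (proj1_sig y) = top.
Proof.
  (* In the joined oracle, entry 0 is [n], entry 1 is the number coordinate [p 0], and entry
     [S (2 * S (2 * k))] is [odds p k]. *)
  assert (H : effective (fun o k =>
    ifz (neqn (o 1) (o 0)) (o (S (2 * S (2 * k)))) 0)).
  { apply effective_ifz; [apply effective_neqn|..]; effective;
      apply effective_const. }
  destruct H as [d Hd]; exists d; intros A n.
  pose (f := fun y : S_space A =>
    if Nat.eq_dec (fst (proj1_sig y)) n then snd (proj1_sig y) else bot).
  assert (HR : realises (X := S_space A) (Y := Sierpinski)
    (coded (fibre_code d n)) f).
  { intros p y Hp.
    exists (fun k => if Nat.eq_dec (p 0) n then odds p k else 0); split.
    - exists d; split; [reflexivity|].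
      intro k; specialize (Hd (join (tail (fibre_code d n)) p) k).
      cbv beta in Hd; rewrite neqn_ifz, join_odd in Hd.
      change (join (tail (fibre_code d n)) p 1) with (p 0) in Hd.
      change (join (tail (fibre_code d n)) p 0) with n in Hd.
      unfold odds; rewrite Nat.add_1_r; exact Hd.
    - destruct Hp as [H0 H1]; change (p 0 = fst (proj1_sig y)) in H0.
      unfold f; rewrite H0; destruct Nat.eq_dec; [exact H1|].
      split; auto. }
  pose proof (coded_cont_realisable _ _ HR) as HC.
  exists (exist _ f HC); split; [exact HR|].
  intro y; unfold member, f; simpl; destruct Nat.eq_dec; intuition discriminate.
Qed.

Lemma ce_of_overt A : computably_overt (S_space A) -> ce A.
Proof.
  intros (O & HO & p & Hp & HN); apply effective_computable_seq in Hp.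
  destruct fibre_program as [d Hd]; apply ce_iff.
  (* [p] is applied to the fibre over [n], and entry [k] of the answer is run for [t] steps. After
     [pred], a non-zero value means a halt with non-zero output. *)
  pose (b := fun n k t =>
    pred (result (join (tail p) (fibre_code d n)) (p 0) k t)).
  exists (fun z => b (pi1 z) (pi1 (pi2 z)) (pi2 (pi2 z))); split.
  - apply effective_pred.
    apply (effective_result
      (fun _ z => join (tail p) (fibre_code d (pi1 z)))); effective.
    apply (effective_join (fun _ _ => tail p)
      (fun _ z => fibre_code d (pi1 (pi1 z)))); unfold tail, fibre_code.
    + apply (effective_comp (fun _ => p)); effective.
    + effective.
    + effective.
  - intro n; destruct (Hd A n) as (U & NU & HU).
    destruct (HN _ _ NU) as (q & (c & Ec & Hq) & Nq).
    assert (EA : A n <-> nonempty U).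
    { split.
      - intro H; exists (S_point A n); apply HU; split; [reflexivity|].
        simpl; destruct excluded_middle_informative; tauto.
      - intros [[[m s] Hy] HM]; apply HU in HM; simpl in *.
        destruct HM as [-> ->], Hy as [[H _]|[_ H]]; [exact H | discriminate]. }
    rewrite EA, <- HO; unfold member; rewrite (nonzero_top _ _ Nq).
    unfold b; split.
    + intros [k Hk]; specialize (Hq k); apply eval_iff_result in Hq.
      destruct Hq as [t Ht]; exists (pr k t).
      repeat rewrite ?pi1_pr, ?pi2_pr; rewrite <- Ec, Ht; exact Hk.
    + intros [z Hz]; rewrite pi2_pr, pi1_pr, <- Ec in Hz.
      exists (pi1 z).
      destruct (result _ _ _ (pi2 z)) as [|v] eqn:E; [contradiction|].
      assert (Hv : eval (join (tail p) (fibre_code d n)) c (pi1 z) v)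
        by (apply eval_iff_result; eauto).
      rewrite (eval_fun _ _ _ _ _ (Hq _) Hv); exact Hz.
Qed.

Lemma ce_of_separable A : computably_separable (S_space A) -> ce A.
Proof.
  intros (s & Hs & Hd); apply computable_program in Hs; destruct Hs as [c Hc].
  assert (Hq : forall i, exists q, Phi c (fun _ => i) q /\ names q (s i))
    by (intro i; apply Hc; reflexivity).
  (* The points over [n] form a non-empty open set, which a dense sequence must meet. *)
  assert (Hsurj : forall n, exists i, fst (proj1_sig (s i)) = n).
  { intro n.
    pose (f := fun y : S_space A =>
      if Nat.eq_dec (fst (proj1_sig y)) n then top else bot).
    assert (Hf : @computable (S_space A) Sierpinski f).
    { apply (computable_effective (X := S_space A) (Y := Sierpinski) f
        (fun p _ => ifz (neqn (p 0) n) 1 0)).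
      - apply effective_ifz; [apply effective_neqn|..]; effective.
      - intros p y [H0 _]; change (p 0 = fst (proj1_sig y)) in H0.
        apply top_nonzero; unfold f; rewrite <- H0.
        setoid_rewrite neqn_ifz; destruct Nat.eq_dec.
        + split; auto; exists 0; discriminate.
        + split; [discriminate | intros [_ []]; reflexivity]. }
    destruct (Hd (exist _ f (computable_cont _ Hf))) as [i Hi].
    - exists (S_point A n); unfold member, f; simpl.
      destruct Nat.eq_dec; congruence.
    - exists i; unfold member, f in Hi; simpl in Hi.
      destruct Nat.eq_dec; [assumption | discriminate]. }
  apply ce_iff.
  pose (r := fun i k t => result (fun _ => i) (encode c) k t).
  (* A witness consists of an index [i], a position [k] in the Sierpinski half, and running times
     [t] and [u] for entries 0 and [2 * k + 1] of the name of [s i]. *)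
  exists (fun z => let n := pi1 z in let i := pi1 (pi2 z) in
    let k := pi1 (pi2 (pi2 z)) in
    let t := pi1 (pi2 (pi2 (pi2 z))) in let u := pi2 (pi2 (pi2 (pi2 z))) in
    ifz (neqn (r i 0 t) (S n)) (pred (r i (S (2 * k)) u)) 0); split.
  - cbv zeta; unfold r.
    assert (HE : forall I K T, effective I -> effective K -> effective T ->
      effective (fun o z => result (fun _ => I o z) (encode c) (K o z) (T o z))).
    { intros I K T HI HK HT.
      apply (effective_result (fun o z _ => I o z)); auto.
      - apply (effective_comp I); effective.
      - apply effective_const. }
    apply effective_ifz; [apply effective_neqn|apply effective_pred|];
      try apply HE; effective.
  - intro n; cbv zeta; split.
    + intro HA; destruct (Hsurj n) as [i Hi].
      destruct (Hq i) as (q & Eq & Nq).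
      rewrite <- (S_point_eq A (s i)), Hi in Nq; apply names_S_point in Nq.
      destruct Nq as [N0 NA]; destruct (proj1 NA HA) as [k Hk].
      pose proof (Eq 0) as E0; apply eval_iff_result in E0.
      destruct E0 as [t Ht].
      unfold odds in Hk; rewrite Nat.add_1_r in Hk.
      pose proof (Eq (S (2 * k))) as E1; apply eval_iff_result in E1.
      destruct E1 as [u Hu].
      exists (pr i (pr k (pr t u))).
      repeat rewrite ?pi1_pr, ?pi2_pr.
      unfold r; rewrite Ht, Hu, N0, neqn_ifz.
      destruct Nat.eq_dec; [exact Hk | congruence].
    + intros [z Hz]; revert Hz.
      rewrite pi1_pr, pi2_pr, neqn_ifz; destruct Nat.eq_dec as [Et|];
        [|congruence].
      intro Hz; unfold r in *.
      destruct (Hq (pi1 z)) as (q & Eq & Nq).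
      rewrite <- (S_point_eq A (s (pi1 z))) in Nq; apply names_S_point in Nq.
      assert (E0 : q 0 = n)
        by (apply (eval_fun _ _ _ _ _ (Eq 0)), eval_iff_result; eauto).
      destruct Nq as [N0 NA]; rewrite <- N0, E0 in NA; apply NA.
      exists (pi1 (pi2 z)).
      destruct (result _ _ (S _) _) as [|v] eqn:E; [contradiction|].
      unfold odds; rewrite Nat.add_1_r.
      assert (Hv : eval (fun _ => pi1 z) c (S (2 * pi1 (pi2 z))) v)
        by (apply eval_iff_result; eauto).
      rewrite (eval_fun _ _ _ _ _ (Eq _) Hv); exact Hz.
Qed.

(** An open set is non-empty iff it contains some [s n]. As the names [Q n] are uniformly
    computable, all these membership tests can be dovetailed. *)
Lemma overt_of_dense_names (X : RepSpace) (Q : nat -> baire) (s : nat -> X) :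
  effective (fun _ z => Q (pi1 z) (pi2 z)) ->
  (forall n, names (Q n) (s n)) ->
  (forall U : Opens X, nonempty U -> exists n, member (s n) U) ->
  computably_overt X.
Proof.
  intros HQ HN Hd.
  (* At [(n, (k, t))], [V] runs for [t] steps the computation of entry [k] of the
     name of the value at [s n] of the open set named by the oracle. *)
  pose (V := fun (o : baire) z =>
    pred (result (join (tail (fun i => o (S (2 * i)))) (Q (pi1 z)))
      (o 1) (pi1 (pi2 z)) (pi2 (pi2 z)))).
  assert (HV : effective V).
  { apply effective_pred.
    apply (effective_result (fun o z =>
      join (tail (fun i => o (S (2 * i)))) (Q (pi1 z)))); effective.
    apply (effective_join (fun o _ => tail (fun i => o (S (2 * i))))
      (fun _ z => Q (pi1 (pi1 z)))); unfold tail; effective.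
    apply (effective_ext (fun o z => (fun z => Q (pi1 z) (pi2 z))
      (pr (pi1 (pi1 (pi1 z))) (pi2 z)))).
    - intros _ z; rewrite pi1_pr, pi2_pr; reflexivity.
    - apply (effective_comp _ (fun _ z => pr (pi1 (pi1 (pi1 z))) (pi2 z)) HQ);
        effective. }
  destruct HV as [v Hv].
  (* The index of [v] followed by zeros: its oracle is then [join zero_seq u], with [u] in the odd
     positions that [V] reads. *)
  pose (w := fun n => ifz n (encode v) 0).
  pose (f := fun U : Opens X =>
    if excluded_middle_informative (nonempty U) then top else bot).
  assert (HR : realises (X := Opens X) (Y := Sierpinski) (coded w) f).
  { intros u U NU; exists (V (join zero_seq u)); split.
    - exists v; split; [reflexivity | exact (Hv (join zero_seq u))].
    - assert (EV : forall z, V (join zero_seq u) z = pred (result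
        (join (tail u) (Q (pi1 z))) (u 0) (pi1 (pi2 z)) (pi2 (pi2 z)))).
      { intro z; unfold V; f_equal; f_equal; f_equal.
        extensionality i; unfold tail; apply join_odd. }
      apply top_nonzero.
      transitivity (nonempty U).
      { unfold f; destruct excluded_middle_informative; intuition discriminate. }
      split.
      + intro H; destruct (Hd U H) as [n Hn].
        destruct (NU _ _ (HN n)) as (q & (c & Ec & Hq) & Nq).
        apply (nonzero_top _ _ Nq) in Hn; destruct Hn as [k Hk].
        specialize (Hq k); apply eval_iff_result in Hq; destruct Hq as [t Ht].
        exists (pr n (pr k t)); rewrite EV.
        repeat rewrite ?pi1_pr, ?pi2_pr; rewrite <- Ec, Ht; exact Hk.
      + intros [z Hz]; rewrite EV in Hz; exists (s (pi1 z)).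
        destruct (NU _ _ (HN (pi1 z))) as (q & (c & Ec & Hq) & Nq).
        apply (nonzero_top _ _ Nq); exists (pi1 (pi2 z)).
        rewrite <- Ec in Hz.
        destruct (result _ _ _ _) as [|m] eqn:E; [contradiction|].
        assert (Hm : eval (join (tail u) (Q (pi1 z))) c (pi1 (pi2 z)) m)
          by (apply eval_iff_result; eauto).
        rewrite (eval_fun _ _ _ _ _ (Hq _) Hm); exact Hz. }
  exists (exist _ f (coded_cont_realisable _ _ HR)); split.
  - intro U; unfold member, f; simpl.
    destruct excluded_middle_informative; intuition discriminate.
  - exists w; split; [|exact HR].
    assert (HW : effective (fun _ => w)).
    { unfold w; apply effective_ifz; [..|apply effective_const];
        [apply effective_id | apply effective_const]. }
    destruct HW as [e He]; exists e; exact (He zero_seq).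
Qed.

(** [S_point A] runs through all points, hence is dense, and the tests for [A] supply names
    uniformly. *)
Lemma overt_of_ce A : ce A -> computably_overt (S_space A).
Proof.
  intro H; apply ce_iff in H; destruct H as (a & Ha & HA).
  apply (overt_of_dense_names (S_space A)
    (fun n => join (fun _ => n) (fun t => a (pr n t))) (S_point A)).
  - apply (effective_join (fun _ z _ => pi1 z) (fun _ z t => a (pr (pi1 z) t)));
      effective.
    apply (effective_comp (fun _ => a)); effective.
  - intro n; apply names_S_point; split; [reflexivity|].
    rewrite odds_join; apply HA.
  - intros U [y Hy]; exists (fst (proj1_sig y)); rewrite S_point_eq; exact Hy.
Qed.

Theorem proposition22 (A : nat -> Prop) :
  (computably_isomorphic (S_space A) Nat_rep <->
     complete_computable_metric (S_space A)) /\
  (complete_computable_metric (S_space A) <->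
     computably_quasi_polish (S_space A)) /\
  (computably_quasi_polish (S_space A) <->
     computably_separable (S_space A)) /\
  (computably_separable (S_space A) <->
     computably_overt (S_space A)) /\
  (computably_overt (S_space A) <-> ce A).
Proof.
  assert (H12 : computably_isomorphic (S_space A) Nat_rep ->
    complete_computable_metric (S_space A)).
  { intro H; destruct Nat_complete_metric as (d & Hd & E); exists d.
    split; [exact Hd | exact (computably_isomorphic_trans _ _ _ H E)]. }
  pose proof (metric_separable A) as H24.
  pose proof (ce_of_separable A) as H46.
  pose proof (ce_of_overt A) as H56.
  pose proof (overt_of_ce A) as H65.
  assert (H61 : ce A -> computably_isomorphic (S_space A) Nat_rep)
    by (intro H; apply computably_isomorphic_sym, iso_of_ce, H).
  assert (H35 : computably_quasi_polish (S_space A) ->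
    computably_overt (S_space A)) by (intros [_ H]; exact H).
  assert (H63 : ce A -> computably_quasi_polish (S_space A)).
  { intro H; split; [|exact (H65 H)].
    destruct Nat_precomputably_quasi_polish as (R & HR & HC & E); exists R.
    split; [exact HR|]; split; [exact HC|].
    exact (computably_isomorphic_trans _ _ _ (H61 H) E). }
  (* The implications close up: 1 to 2 to 4 to 6, 3 to 5 to 6, and 6 back to 1, 3 and 5. *)
  tauto.
Qed.
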